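(* Let $\psi\in L^\infty(\mathbb{R}_+)$, where $\mathbb{R}_+=\{x\in\mathbb{R}:x\ge0\}$, let $\alpha\in\mathbb{C}$, and let $\mathscr{L}\psi(s)=\int_0^\infty\psi(t)e^{-st}\,dt$ be the Laplace transform of $\psi$ on the right half plane $\mathbb{C}^+=\{s\in\mathbb{C}:\mathrm{Re}\,s>0\}$. If $\mathscr{L}\psi(s)-\frac{\alpha}{s}$ has $H^1$ boundary behavior at $s=0$, then $\psi$ is one-sidedly almost convergent to $\alpha$, that is, $$\lim_{\theta\to\infty}\frac1\theta\int_x^{x+\theta}\psi(t)\,dt=\alpha$$ uniformly in $x\ge0$.
   Context: A function $f$ on $\mathbb{C}^+$ has $H^1$ boundary behavior at $z_0=iy_0$ ($y_0\in\mathbb{R}$) if there exist $\delta>0$ and a function $F\in L^1(y_0-\delta,y_0+\delta)$ such that $f(x+iy)$ converges to $F(y)$ in $L^1(y_0-\delta,y_0+\delta)$ as $x\to0^+$. $L^\infty(\mathbb{R})$ and $L^\infty(\mathbb{R}_+)$ consist of complex-valued essentially bounded measurable functions, and $(f*\psi)(x)=\int_{\mathbb{R}}f(t)\psi(x-t)\,dt$. A mean on $L^\infty(\mathbb{R})$ is $\varphi\in L^\infty(\mathbb{R})^*$ with $\varphi(\psi)\ge0$ for all $\psi\ge0$ and $\varphi(\mathbf1)=1$; it is topologically invariant if $\varphi(f*\psi)=\varphi(\psi)$ for all $\psi\in L^\infty(\mathbb{R})$ and all nonnegative $f\in L^1(\mathbb{R})$ with $\int f=1$. $\mathcal{T}_+$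 is the set of topologically invariant means on $L^\infty(\mathbb{R})$ that vanish on every $\phi\in L^\infty(\mathbb{R})$ with $\lim_{x\to+\infty}\phi(x)=0$. A function $\psi\in L^\infty(\mathbb{R})$ is one-sidedly almost convergent to $\alpha$ if $\varphi(\psi)=\alpha$ for every $\varphi\in\mathcal{T}_+$; a function in $L^\infty(\mathbb{R}_+)$ is called so if its extension by $0$ to the negative reals is. *)

(* Defs.v *)
(* The topology on the complex numbers [R[i]] is carried by the alias [R[i]^o]. *)
From HB Require Import structures.
From mathcomp Require Import all_boot all_order all_algebra.
From mathcomp Require Import all_classical all_reals all_analysis ess_sup_inf.
From mathcomp Require Export complex.

Set Implicit Arguments.
Unset Strict Implicit.
Unset Printing Implicit Defensive.

Import Order.TTheory GRing.Theory Num.Theory numFieldNormedType.Exports.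
Import ComplexField.Normc.

Local Open Scope classical_set_scope.
Local Open Scope ring_scope.
Local Open Scope complex_scope.

Section ComplexFunctions.
Context {R : realType}.
Implicit Types (D : set R) (f g psi : R -> R[i]).

Local Notation mu := (@lebesgue_measure R).

Definition cmeasurable D f : Prop :=
  measurable_fun D (fun x => complex.Re (f x)) /\
  measurable_fun D (fun x => complex.Im (f x)).

Definition cintegral D f : R[i] :=
  Rintegral mu D (fun x => complex.Re (f x)) +i*
  Rintegral mu D (fun x => complex.Im (f x)).

(* [L^1(D)] and [L^oo(D)] are predicates on representatives: the values outside
   [D] are irrelevant, and equality almost everywhere is not quotiented out. *)
Definition L1 D f : Prop :=
  cmeasurable D f /\ (\int[mu]_(x in D) (normc (f x))%:E < +oo)%E.

Definition Linfty_norm D f : \bar R :=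
  ess_sup mu (EFin \o ((fun x => normc (f x)) \_ D)).

Definition Linfty D f : Prop :=
  cmeasurable D f /\ (Linfty_norm D f < +oo)%E.

Definition convolution f psi (x : R) : R[i] :=
  cintegral setT (fun t => f t * psi (x - t)).

Definition cexp (z : R[i]) : R[i] :=
  (expR (complex.Re z))%:C * (cos (complex.Im z) +i* sin (complex.Im z)).

Definition laplace psi (s : R[i]) : R[i] :=
  cintegral `[0, +oo[ (fun t => psi t * cexp (- (s * t%:C))).

(* Boundary behavior at the point [i y0] of a function on [Re s > 0]; only the
   values of [f] on that half plane matter. *)
Definition H1_boundary_behavior (f : R[i] -> R[i]) (y0 : R) : Prop :=
  exists2 delta : R, 0 < delta &
  exists2 F : R -> R[i], L1 `]y0 - delta, y0 + delta[ F &
    (\forall x \near 0^'+,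
       L1 `]y0 - delta, y0 + delta[ (fun y => f (x +i* y))) /\
    (\int[mu]_(y in `](y0 - delta)%R, (y0 + delta)%R[)
       (normc (f (x +i* y)%C - F y)%R)%:E)%E @[x --> 0^'+] --> 0%E.

(* An element of the dual of [L^oo(R)] is given by its values on
   representatives; [phi] is unconstrained outside [Linfty setT]. Linearity and
   boundedness make [phi f] depend only on the class of [f] modulo null sets. *)
Definition Linfty_dual (phi : (R -> R[i]) -> R[i]) : Prop :=
  (forall (a : R[i]) f g, Linfty setT f -> Linfty setT g ->
     phi (fun x => a * f x + g x) = a * phi f + phi g) /\
  (exists C : R, forall f, Linfty setT f ->
     ((normc (phi f))%:E <= C%:E * Linfty_norm setT f)%E).

(* In [R[i]], [0 <= z] means that [z] is real and nonnegative. *)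
Definition mean (phi : (R -> R[i]) -> R[i]) : Prop :=
  [/\ Linfty_dual phi,
      forall psi, Linfty setT psi -> (\forall x \ae mu, 0 <= psi x) ->
        0 <= phi psi
    & phi (fun=> 1) = 1].

Definition topologically_invariant (phi : (R -> R[i]) -> R[i]) : Prop :=
  forall psi f, Linfty setT psi -> L1 setT f ->
    (\forall x \ae mu, 0 <= f x) -> cintegral setT f = 1 ->
    phi (convolution f psi) = phi psi.

Definition Tplus : set ((R -> R[i]) -> R[i]) :=
  [set phi | [/\ mean phi, topologically_invariant phi
    & forall psi, Linfty setT psi ->
        (psi x : R[i]^o) @[x --> +oo] --> (0 : R[i]^o) -> phi psi = 0]].

Definition one_sidedly_almost_convergent psi (alpha : R[i]) : Prop :=
  forall phi, Tplus phi -> phi psi = alpha.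

Definition zero_extension psi (x : R) : R[i] := if 0 <= x then psi x else 0.

End ComplexFunctions.

(* Main.v *)
From HB Require Import structures.
Require Import Defs.
From mathcomp Require Import all_boot all_order all_algebra.
From mathcomp Require Import all_classical all_reals all_analysis.
From mathcomp Require Import ess_sup_inf measurable_realfun.
From mathcomp Require Import ring lra.

(** Let [w = psi - alpha] on the half line and [w = 0] on the negative axis. Its
    Laplace transform is G(s) = L psi(s) - alpha / s, so the hypothesis concerns the
    behavior of G near 0. For [e > 0] the Fourier identity [fejer_laplace] reads
<<
    int e^(-et) w(t) K_r(x - t) dt
      = int_(-r)^r (r - |y|) e^(ixy) G(e + iy) dy,
>>
    where K_r is the Fejér kernel, the Fourier transform of the tent r - |y|. The right
    side is at most r times the integral of |G(e + iy)| over [-r, r], while the mass of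
    K_r is at least a constant times r ([fejer_mass]). If G(e + i.) converges in L^1 near
    0, then for small r the integral of |G(e + iy)| over [-r, r] is small for all e close
    to 0 ([H1_boundary_small]); letting e tend to 0, the convolution of w with the
    normalized K_r is small uniformly in x ([laplace_re_smoothable]).

    So w can be smoothed by probability densities k to uniformly small functions, and
    each of the two conclusions follows from this alone. A topologically invariant mean
    takes the same value at w and at the convolution k * w, hence vanishes at w
    ([smoothable_mean0]); the remaining part of psi is alpha times the indicator of the
    half line, on which a mean in [Tplus] takes the value alpha ([smoothable_one_sided]).
    Averaging over a long interval almost commutes with the convolution, because
    translating an interval of length theta by a fixed amount changes the integral of a
    bounded function by o(theta); hence the averages of w tend to 0 uniformly
    ([smoothable_average]).

    Everything is done in real coordinates: w = u + i v with u and v real, measurable and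
    bounded everywhere, and the real and imaginary parts of its transform at e + i y are
    [laplace_re u v e y] and [laplace_re v (\- u) e y]. *)

Set Implicit Arguments.
Unset Strict Implicit.
Unset Printing Implicit Defensive.

Import Order.TTheory GRing.Theory Num.Theory numFieldNormedType.Exports.
Import ComplexField.Normc.

Local Open Scope classical_set_scope.
Local Open Scope ring_scope.
Local Open Scope complex_scope.

(** * Domination, Fubini's theorem and reflection *)

Section dominated.
Context d (T : measurableType d) (R : realType) (mu : {measure set T -> \bar R}).

Lemma integrable_le (D : set T) (f g : T -> R) : measurable D ->
  measurable_fun D f -> mu.-integrable D (EFin \o g) ->
  (forall x, D x -> `|f x| <= g x) -> mu.-integrable D (EFin \o f).
Proof.
move=> mD mf ig fg; apply: (le_integrable mD _ _ ig).
  exact/measurable_EFinP.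
by move=> x Dx /=; rewrite lee_fin (le_trans (fg _ Dx))// ler_norm.
Qed.

Lemma integrable_scale (D : set T) (c : R) (f : T -> R) : measurable D ->
  mu.-integrable D (EFin \o f) -> mu.-integrable D (EFin \o (fun x => c * f x)).
Proof. by move=> mD; exact: integrableZl. Qed.

Lemma le_norm_Rintegral_dominated (D : set T) (f g : T -> R) : measurable D ->
  measurable_fun D f -> mu.-integrable D (EFin \o g) ->
  (forall x, D x -> `|f x| <= g x) ->
  `|\int[mu]_(x in D) f x| <= \int[mu]_(x in D) g x.
Proof.
move=> mD mf ig fg.
have if' : mu.-integrable D (EFin \o f) by exact: integrable_le fg.
apply: (le_trans (le_normr_Rintegral mD if')).
apply: le_Rintegral => //.
exact: (integrable_norm if').
Qed.

End dominated.

Section product.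
Context d1 d2 (T1 : measurableType d1) (T2 : measurableType d2) (R : realType).
Variables (m1 : {sigma_finite_measure set T1 -> \bar R}).
Variables (m2 : {sigma_finite_measure set T2 -> \bar R}).

(** Adding the integrable majorant [a x * b y] makes the integrand nonnegative, so
    that Tonelli's measurability statement covers signed integrands. *)
Lemma measurable_parametric_Rintegral (f : T1 * T2 -> R) (a : T1 -> R) (b : T2 -> R) :
  measurable_fun setT f -> measurable_fun setT a ->
  m2.-integrable setT (EFin \o b) ->
  (forall x y, `|f (x, y)| <= a x * b y) ->
  measurable_fun setT (fun x => \int[m2]_y f (x, y)).
Proof.
move=> mf ma ib fab.
have mb : measurable_fun setT b by exact/measurable_EFinP/(measurable_int m2).
pose g z := f z + a z.1 * b z.2.
have mg : measurable_fun setT g.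
  by apply: measurable_funD => //; apply: measurable_funM;
    apply: measurableT_comp.
have g0 z : 0 <= g z.
  case: z => x y; have := fab x y.
  by rewrite /g/= ler_norml => /andP[]; lra.
have -> : (fun x => \int[m2]_y f (x, y)) =
    (fun x => \int[m2]_y g (x, y) - a x * \int[m2]_y b y).
  apply/funext => x; rewrite -RintegralZl// -RintegralB//.
  - by apply: eq_Rintegral => y _; rewrite /g/= addrK.
  - apply: (@integrable_le _ _ _ _ _ _ (fun y => 2 * (a x * b y))) => //.
    + exact: measurableT_comp (pair1_measurable x).
    + by do 2 apply: integrable_scale => //.
    + move=> y _; rewrite /g/=; have := fab x y => h.
      rewrite (le_trans (ler_normD _ _))// mulrDl mul1r lerD//.
      by rewrite ger0_norm// (le_trans _ h).
  - exact: integrable_scale.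
apply: measurable_funB; last first.
  by apply: measurable_funM => //; exact: measurable_cst.
apply: measurableT_comp => //.
apply: (measurable_fun_fubini_tonelli_F (EFin \o g)) => //.
exact/measurable_EFinP.
Qed.

(** A product majorant makes every section integrable, not merely almost every
    one, so the inner integrals can be taken as real numbers throughout. *)
Lemma Rintegral_Fubini (f : T1 * T2 -> R) (a : T1 -> R) (b : T2 -> R) :
  measurable_fun setT f ->
  m1.-integrable setT (EFin \o a) -> m2.-integrable setT (EFin \o b) ->
  (forall x y, `|f (x, y)| <= a x * b y) ->
  \int[m1]_x \int[m2]_y f (x, y) = \int[m2]_y \int[m1]_x f (x, y).
Proof.
move=> mf ia ib fab.
have if2 x : m2.-integrable setT (fun y => (f (x, y))%:E).
  apply: (@integrable_le _ _ _ _ _ _ (fun y => a x * b y)) => //.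
    exact: measurableT_comp (pair1_measurable x).
  exact: integrable_scale.
have if1 y : m1.-integrable setT (fun x => (f (x, y))%:E).
  apply: (@integrable_le _ _ _ _ _ _ (fun x => b y * a x)) => //.
  - exact: measurableT_comp (pair2_measurable y).
  - exact: integrable_scale.
  - by move=> x _; rewrite mulrC.
have iab : (m1 \x m2)%E.-integrable setT (EFin \o f).
  apply/integrable12ltyP => /=; first exact/measurable_EFinP.
  apply: (@le_lt_trans _ _ (\int[m1]_x (`|a x|%:E * (\int[m2]_y `|b y|)%R%:E))%E).
    apply: ge0_le_integral => //=.
    - by move=> x _; apply: integral_ge0 => y _; rewrite lee_fin.
    - apply: (measurable_fun_fubini_tonelli_F (EFin \o (fun z => `|f z|))) => //=.
      by apply/measurable_EFinP; exact: measurableT_comp.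
    - apply/measurable_EFinP/measurable_funM => //.
      apply: measurableT_comp => //.
      exact/measurable_EFinP/(measurable_int m1).
    move=> x _.
    rewrite /Rintegral fineK; last first.
      by apply: integrable_fin_num => //; exact: (integrable_norm ib).
    rewrite -ge0_integralZl//=; last first.
      apply/measurable_EFinP; apply: measurableT_comp => //.
      exact/measurable_EFinP/(measurable_int m2).
    apply: ge0_le_integral => //=.
    - apply/measurable_EFinP; apply: measurableT_comp => //.
      exact: measurableT_comp (pair1_measurable x).
    - apply/measurable_EFinP; apply: measurable_funM => //.
      apply: measurableT_comp => //.
      exact/measurable_EFinP/(measurable_int m2).
    by move=> y _; rewrite lee_fin (le_trans (fab _ _))// -normrM ler_norm.
  under eq_integral do rewrite -EFinM mulrC.
  have /integrableZl : m1.-integrable setT (EFin \o (fun x => `|a x|)).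
    exact: (integrable_norm ia).
  by move=> /(_ measurableT (\int[m2]_y `|b y|)) /integrable_lty; apply.
rewrite /Rintegral; congr fine.
under eq_integral => x _.
  rewrite fineK; last by apply: integrable_fin_num => //; exact: if2.
  over.
rewrite (Fubini iab).
apply: eq_integral => y _.
by rewrite fineK//; apply: integrable_fin_num => //; exact: if1.
Qed.

End product.

Section reflection.
Context {R : realType}.
Local Notation mu := (@lebesgue_measure R).
Implicit Types (f : R -> R) (x : R).

Lemma measurable_rsub x : measurable_fun [set: R] (fun t : R => x - t).
Proof. by apply: measurable_funB => //; exact: measurable_id. Qed.

Let rsub x : measurableTypeR R -> measurableTypeR R := fun t => x - t.

Let mrsub x : measurable_fun setT (rsub x). Proof. exact: measurable_rsub. Qed.

Let nu x : {measure set (measurableTypeR R) -> \bar R} :=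
  measure_function_pushforward__canonical__measure_function_Measure mu (mrsub x).

(* A measure on the line is determined by its values on half-open intervals; the
   reflection turns ]a, b] into [x - b, x - a[, which has the same length. *)
Let nuE x (A : set (measurableTypeR R)) : measurable A -> mu A = nu x A.
Proof.
move=> mA.
apply: (@lebesgue_measure_unique R (nu x) _ A mA) => _ [[a b] /= _ <-].
rewrite /pushforward (_ : _ @^-1` _ = `[x - b, x - a[%classic); last first.
  by rewrite /rsub; apply/seteqP; split=> t /=; rewrite !in_itv/=; lra.
rewrite !lebesgue_measure_itv/= !lte_fin ltrD2l ltrN2.
by case: ifP => // _; rewrite -!EFinD; congr EFin; lra.
Qed.

Lemma integrable_rsub x f : mu.-integrable setT (EFin \o f) ->
  mu.-integrable setT (fun t => (f (x - t))%:E).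
Proof.
move=> /integrableP[/measurable_EFinP mf fi]; apply/integrableP; split.
  by apply/measurable_EFinP; exact: (measurableT_comp mf (measurable_rsub x)).
move: fi; rewrite (eq_measure_integral (nu x)); last first.
  by move=> A mA _; exact: nuE.
rewrite (ge0_integral_pushforward (mrsub x))//.
by do 2 apply: measurableT_comp => //.
Qed.

Lemma Rintegral_rsub x f : mu.-integrable setT (EFin \o f) ->
  \int[mu]_t f (x - t) = \int[mu]_t f t.
Proof.
move=> fi; rewrite /Rintegral.
rewrite [in RHS](eq_measure_integral (nu x)); last first.
  by move=> A mA _; exact: nuE.
rewrite (integral_pushforward (mrsub x))//.
- exact: (measurable_int mu).
- by rewrite preimage_setT; exact: (integrable_rsub x fi).
Qed.

End reflection.

(** * The Fejér kernel *)

Section FTC.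
Context {R : realType}.
Local Notation mu := (@lebesgue_measure R).

Lemma Rintegral_FTC2 (F f : R -> R) (a b : R) : a < b ->
  (forall x, is_derive x (1 : R) F (f x)) -> continuous f ->
  \int[mu]_(x in `[a, b]) f x = F b - F a.
Proof.
move=> ab dF cf; rewrite /Rintegral (@continuous_FTC2 _ f F)//.
- exact: continuous_subspaceT.
- have cF x : {for x, continuous F}.
    by apply/differentiable_continuous/derivable1_diffP; case: (dF x).
  split.
  + by move=> x _; case: (dF x).
  + by apply: cvg_at_right_filter; exact: cF.
  + by apply: cvg_at_left_filter; exact: cF.
- by move=> x _; rewrite derive1E; case: (dF x).
Qed.

Lemma integrable_oneDsqrV : mu.-integrable setT (EFin \o (fun x : R => (oneDsqr x)^-1)).
Proof.
apply/integrableP; split.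
  apply/measurable_EFinP; apply: continuous_measurable_fun.
  exact: continuous_oneDsqrV.
under eq_integral => x _.
  rewrite /= ger0_norm; last by rewrite invr_ge0 (le_trans _ (oneDsqr_ge1 x)).
  over.
rewrite ge0_symfun_integralT//=.
- rewrite (_ : [set x | 0 <= x] = `[0%R, +oo[%classic); last first.
    by apply/seteqP; split => x /=; rewrite in_itv/= andbT.
  by rewrite integral0y_oneDsqr -EFinM ltry.
- exact: continuous_oneDsqrV.
- by move=> x /=; rewrite /oneDsqr sqrrN.
Qed.

End FTC.

Section tent.
Context {R : realType}.
Local Notation mu := (@lebesgue_measure R).
Implicit Types (r x y z : R).

Definition tent r y : R := Num.max 0 (r - `|y|).

Lemma tent_ge0 r y : 0 <= tent r y.
Proof. by rewrite le_max lexx. Qed.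

Lemma tent_le r y : 0 <= r -> tent r y <= r.
Proof. by move=> r0; rewrite ge_max r0/= gerBl. Qed.

Lemma tent_out r y : r <= `|y| -> tent r y = 0.
Proof. by move=> ry; apply/max_idPl; rewrite subr_le0. Qed.

Lemma tent_in r y : `|y| <= r -> tent r y = r - `|y|.
Proof. by move=> ry; apply/max_idPr; rewrite subr_ge0. Qed.

Lemma tentN r y : tent r (- y) = tent r y.
Proof. by rewrite /tent normrN. Qed.

Lemma measurable_tent r : measurable_fun setT (tent r).
Proof.
apply: measurable_maxr => //; apply: measurable_funB => //.
Qed.

Lemma tent_le_indic r y : 0 <= r -> tent r y <= r * \1_(`[- r, r]%classic : set R) y.
Proof.
move=> r0; rewrite indicE; case: (leP `|y| r) => h.
  by rewrite mem_set ?mulr1 ?tent_le//= in_itv/= -ler_norml.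
by rewrite tent_out ?(ltW h)// mulr_ge0.
Qed.

Lemma integrable_indic1_itv a b :
  mu.-integrable setT (EFin \o (\1_(`[a, b]%classic : set R) : R -> R)).
Proof.
apply/integrableP; split; first by apply/measurable_EFinP; exact: measurable_indic.
under eq_integral => x _ do rewrite /= ger0_norm//.
by rewrite integral_indic//= setIT lebesgue_measure_itv/=; case: ifP; rewrite ltry.
Qed.

Lemma integrable_indic_itv a b (c : R) :
  mu.-integrable setT (EFin \o (fun y => c * \1_(`[a, b]%classic : set R) y)).
Proof. by apply: integrable_scale => //; exact: integrable_indic1_itv. Qed.

Lemma Rintegral_indic_itv a b (c : R) : a <= b ->
  \int[mu]_z (c * \1_(`[a, b]%classic : set R) z) = c * (b - a).
Proof.
move=> ab; rewrite RintegralZl//; last exact: integrable_indic1_itv.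
rewrite /Rintegral integral_indic//= setIT lebesgue_measure_itv/= lte_fin.
by case: ifPn => //=; rewrite -leNgt => ba; congr (_ * _); lra.
Qed.

Lemma integrable_tent r : 0 <= r -> mu.-integrable setT (EFin \o tent r).
Proof.
move=> r0; apply: (@integrable_le _ _ _ _ _ _ _ _ _ (integrable_indic_itv (- r) r r)) => //.
  exact: measurable_tent.
by move=> x _; rewrite ger0_norm ?tent_ge0 ?tent_le_indic.
Qed.

Lemma integrable_tent_mul r (g : R -> R) : 0 <= r ->
  measurable_fun setT g -> (forall y, `|g y| <= 1) ->
  mu.-integrable setT (EFin \o (fun y => tent r y * g y)).
Proof.
move=> r0 mg g1.
apply: (@integrable_le _ _ _ _ _ _ _ _ _ (integrable_tent r0)) => //.
  by apply: measurable_funM => //; exact: measurable_tent.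
move=> x _; rewrite normrM (ger0_norm (tent_ge0 _ _)).
by rewrite ler_piMr ?tent_ge0.
Qed.

Lemma measurable_cosM z : measurable_fun [set: R] (fun y => cos (z * y)).
Proof.
apply: continuous_measurable_fun => y.
apply: continuous_comp; last exact: continuous_cos.
by apply: continuousM; [exact: cvg_cst|exact: cvg_id].
Qed.

Lemma measurable_sinM z : measurable_fun [set: R] (fun y => sin (z * y)).
Proof.
apply: continuous_measurable_fun => y.
apply: continuous_comp; last exact: continuous_sin.
by apply: continuousM; [exact: cvg_cst|exact: cvg_id].
Qed.

(** The integrand is odd, and Lebesgue measure is invariant under reflection. *)
Lemma Rintegral_tent_sin r z : 0 <= r -> \int[mu]_y (tent r y * sin (z * y)) = 0.
Proof.
move=> r0.
have ih : mu.-integrable setT (EFin \o (fun y => tent r y * sin (z * y))).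
  apply: integrable_tent_mul => //; first exact: measurable_sinM.
  by move=> y; exact: sin_max.
have := Rintegral_rsub 0 ih.
under eq_Rintegral => y _ do rewrite sub0r tentN mulrN sinN mulrN -mulN1r.
by rewrite RintegralZl//; lra.
Qed.

(** On the half-size interval the tent is at least [r / 2]. *)
Lemma Rintegral_tent_ge r : 0 < r -> r ^+ 2 / 2 <= \int[mu]_y tent r y.
Proof.
move=> r0.
apply: (@le_trans _ _ (\int[mu]_y (r / 2 * \1_(`[- (r / 2), r / 2]%classic : set R) y))).
  by rewrite Rintegral_indic_itv; lra.
apply: le_Rintegral => //.
- exact: integrable_indic_itv.
- exact: integrable_tent (ltW r0).
move=> y _; rewrite indicE; have [|_] := boolP (y \in _); last by rewrite mulr0 tent_ge0.
rewrite inE/= in_itv/= -ler_norml mulr1 => yr.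
by rewrite tent_in; lra.
Qed.

(** The Fourier transform of the tent, i.e. the unnormalized Fejér kernel
    2 (1 - cos (r z)) / z^2. Taking the integral as the definition gives the value
    at [z = 0] without a case distinction. *)
Definition fejer r z : R := \int[mu]_y (tent r y * cos (z * y)).

Lemma integrable_tent_cos r z : 0 <= r ->
  mu.-integrable setT (EFin \o (fun y => tent r y * cos (z * y))).
Proof.
move=> r0; apply: integrable_tent_mul => //; first exact: measurable_cosM.
by move=> y; exact: cos_max.
Qed.

Lemma fejer_le r z : 0 <= r -> `|fejer r z| <= 2 * r ^+ 2.
Proof.
move=> r0.
apply: (@le_trans _ _ (\int[mu]_y (r * \1_(`[- r, r]%classic : set R) y))).
  apply: le_norm_Rintegral_dominated => //.
  - by apply: measurable_funM; [exact: measurable_tent|exact: measurable_cosM].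
  - exact: integrable_indic_itv.
  move=> y _; rewrite normrM (ger0_norm (tent_ge0 _ _)).
  by rewrite (le_trans _ (tent_le_indic _ _))// ler_piMr ?tent_ge0 ?cos_max.
by rewrite Rintegral_indic_itv; lra.
Qed.

(** Multiplying by [z ^+ 2] first avoids dividing by [z]: both halves of the
    integrand then have primitives without denominators. *)
Lemma fejer_sqr r z : 0 < r -> z ^+ 2 * fejer r z = 2 * (1 - cos (z * r)).
Proof.
move=> r0; pose g s y := (r + s * y) * cos (z * y) * z ^+ 2.
have cg s : continuous (g s).
  move=> y; rewrite /g; apply: cvgM; last exact: cvg_cst.
  apply: cvgM.
    by apply: cvgD; [exact: cvg_cst|exact: mulrl_continuous].
  apply: continuous_comp; last exact: continuous_cos.
  exact: mulrl_continuous.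
(* [s = 1] is the branch [r + y] of the tent on [- r, 0], and [s = -1] the branch
   [r - y] on [0, r]. *)
pose G s y := z * (r + s * y) * sin (z * y) + s * cos (z * y).
have dG s y : is_derive y (1 : R) (G s) (g s y).
  by rewrite /G /g; apply: is_derive_eq; rewrite /GRing.scale/=; ring.
pose h y := z ^+ 2 * (tent r y * cos (z * y)).
have ih : mu.-integrable setT (EFin \o h).
  by apply: integrable_scale => //; exact: integrable_tent_cos (ltW r0).
have -> : z ^+ 2 * fejer r z = \int[mu]_(y in `[- r, r]) h y.
  rewrite /fejer -RintegralZl//; last exact: integrable_tent_cos (ltW r0).
  rewrite [RHS]Rintegral_mkcond; apply: eq_Rintegral => y _.
  rewrite patchE; case: ifPn => //; rewrite notin_setE/= in_itv/= -ler_norml.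
  by move=> /negP; rewrite -ltNge => /ltW ?; rewrite tent_out// mul0r mulr0.
have ihr : mu.-integrable `[- r, r] (EFin \o h) by exact: integrableS ih.
have rr0 : (BLeft (- r) <= BRight (0 : R))%O by rewrite bnd_simp; lra.
have r0r : (BRight (0 : R) <= BRight r)%O by rewrite bnd_simp; lra.
have := Rintegral_itvB ihr rr0 r0r.
rewrite Rintegral_itv_obnd_cbnd; last by apply: integrableS ih.
have -> : \int[mu]_(y in `[- r, 0]) h y = \int[mu]_(y in `[- r, 0]) g 1 y.
  apply: eq_Rintegral => y; rewrite inE/= in_itv/= => /andP[y1 y2].
  have ny : `|y| = - y by rewrite ler0_norm.
  by rewrite /h /g tent_in ny; [ring|lra].
have -> : \int[mu]_(y in `[0, r]) h y = \int[mu]_(y in `[0, r]) g (-1) y.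
  apply: eq_Rintegral => y; rewrite inE/= in_itv/= => /andP[y1 y2].
  have ny : `|y| = y by rewrite ger0_norm.
  by rewrite /h /g tent_in ny; [ring|lra].
rewrite (Rintegral_FTC2 (F := G 1))//; last by rewrite oppr_lt0.
rewrite (Rintegral_FTC2 (F := G (-1)))// /G !mulr0 sin0 cos0 (mulrN z r) cosN sinN.
lra.
Qed.

(** Positivity is what allows the kernel to be normalized to a probability density,
    the only functions against which a topologically invariant mean is invariant. *)
Lemma fejer_ge0 r z : 0 < r -> 0 <= fejer r z.
Proof.
move=> r0; have [->|z0] := eqVneq z 0.
  rewrite /fejer; under eq_Rintegral do rewrite mul0r cos0 mulr1.
  by apply: Rintegral_ge0 => y _; exact: tent_ge0.
have z2 : 0 < z ^+ 2 by rewrite exprn_even_gt0.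
by rewrite -(pmulr_rge0 _ z2) fejer_sqr// mulr_ge0// subr_ge0 cos_le1.
Qed.

Lemma cos_ge_half y : `|y| <= 1 / 2 -> cos (1 / 2 : R) <= cos y.
Proof.
move=> y2; have -> : cos y = cos `|y|.
  by have [y0|y0] := leP 0 y; [rewrite ger0_norm|rewrite ltr0_norm// cosN].
have pi2 := pi_ge2 R; have y0 := normr_ge0 y.
by rewrite leNgt ltr_cos ?in_itv/= -?leNgt//; apply/andP; split; lra.
Qed.

(** For these [z] the argument of the cosine stays in [-1/2, 1/2] on the support of
    the tent. *)
Lemma fejer_ge r z : 0 < r -> `|z| <= 1 / (2 * r) ->
  cos (1 / 2) * (r ^+ 2 / 2) <= fejer r z.
Proof.
move=> r0 zr.
have c0 : 0 <= cos (1 / 2 : R).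
  by apply: cos_ge0_pihalf; have := pi_ge2 R; lra.
apply: (@le_trans _ _ (cos (1 / 2) * \int[mu]_y tent r y)).
  by rewrite ler_wpM2l// Rintegral_tent_ge.
rewrite -RintegralZl//; last exact: integrable_tent (ltW r0).
apply: le_Rintegral => //.
- by apply: integrable_scale => //; exact: integrable_tent (ltW r0).
- exact: integrable_tent_cos (ltW r0).
move=> y _; have [yr|/ltW yr] := leP `|y| r; last by rewrite tent_out// mulr0 mul0r.
rewrite mulrC ler_wpM2l ?tent_ge0// cos_ge_half// normrM.
rewrite (le_trans (ler_pM _ _ zr yr))//.
by rewrite le_eqVlt; apply/orP; left; apply/eqP; field; rewrite gt_eqF.
Qed.

Lemma measurable_fejer r : 0 <= r -> measurable_fun setT (fejer r).
Proof.
move=> r0.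
have := @measurable_parametric_Rintegral _ _ _ _ _ mu
  (fun z : R * R => tent r z.2 * cos (z.1 * z.2)) (cst 1) (tent r).
apply => //.
- apply: measurable_funM.
    by apply: measurableT_comp => //; exact: measurable_tent.
  apply: measurableT_comp; first exact: continuous_measurable_fun (@continuous_cos R).
  by apply: measurable_funM.
- exact: integrable_tent.
move=> x y /=; rewrite mul1r normrM (ger0_norm (tent_ge0 _ _)).
by rewrite ler_piMr ?tent_ge0 ?cos_max.
Qed.

(** Boundedness near 0 and decay like 4 / z^2 combine into one majorant of the form
    C / (1 + z^2). *)
Lemma integrable_fejer r : 0 < r -> mu.-integrable setT (EFin \o fejer r).
Proof.
move=> r0.
have mT : measurable [set: measurableTypeR R] by [].
apply: (integrable_le _ _ (integrable_scale (2 * r ^+ 2 + 4) mT integrable_oneDsqrV)) => //.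
  exact: measurable_fejer (ltW r0).
move=> z _; rewrite ler_pdivlMr ?(lt_le_trans _ (oneDsqr_ge1 z))//.
rewrite /oneDsqr mulrDr mulr1 lerD// ?fejer_le// ?(ltW r0)//.
rewrite ger0_norm ?fejer_ge0// mulrC fejer_sqr//.
by have := cos_geN1 (z * r); lra.
Qed.

(** The mass grows at least linearly in [r], like the factor [r] by which the tent
    bounds the Fourier side. After normalization that factor disappears, and the
    bound on the smoothed function does not degenerate as [r] tends to 0. *)
Lemma fejer_mass r : 0 < r -> cos (1 / 2) / 2 * r <= \int[mu]_z fejer r z.
Proof.
move=> r0.
pose c := cos (1 / 2) * (r ^+ 2 / 2).
pose d := 1 / (2 * r).
have d0 : 0 < d by rewrite divr_gt0// mulr_gt0.
apply: (@le_trans _ _ (\int[mu]_y (c * \1_(`[- d, d]%classic : set R) y))).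
  rewrite Rintegral_indic_itv; last lra.
  by rewrite le_eqVlt; apply/orP; left; apply/eqP; rewrite /c /d; field; rewrite gt_eqF.
apply: le_Rintegral => //.
- exact: integrable_indic_itv.
- exact: integrable_fejer.
move=> y _; rewrite indicE; have [|_] := boolP (y \in _); last by rewrite mulr0 fejer_ge0.
rewrite inE/= in_itv/= -ler_norml mulr1 => yr.
exact: fejer_ge.
Qed.

End tent.

(** * Laplace transforms of sine and cosine *)

Section damped.
Context {R : realType}.
Local Notation mu := (@lebesgue_measure R).
Implicit Types (e x y t : R) (u v : R -> R).

Lemma continuous_expM (c : R) : continuous (fun t : R => expR (c * t)).
Proof.
move=> t; apply: continuous_comp; last exact: continuous_expR.
exact: mulrl_continuous.
Qed.

Lemma measurable_expM (c : R) : measurable_fun [set: R] (fun t => expR (c * t)).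
Proof. exact: continuous_measurable_fun (@continuous_expM c). Qed.

Lemma cvgy_expM e : 0 < e -> expR (- e * t) @[t --> +oo] --> (0 : R).
Proof.
move=> e0; under eq_fun do rewrite mulNr.
apply: (@cvg_comp _ _ _ (fun t => e * t) (fun s => expR (- s))); last exact: cvgr_expR.
by apply: gt0_cvgMry => //; exact: cvg_id.
Qed.

Lemma ge0_FTC2y (F f : R -> R) (l : R) : (forall t, 0 <= t -> 0 <= f t) ->
  (forall t, is_derive t (1 : R) F (f t)) -> continuous f ->
  F t @[t --> +oo] --> l ->
  (\int[mu]_(t in `[0%R, +oo[) (f t)%:E = (l - F 0)%:E)%E.
Proof.
move=> f0 dF cf Fl; rewrite (@ge0_continuous_FTC2y R f F 0 l)//.
- exact: continuous_subspaceT.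
- apply: cvg_at_right_filter; apply/differentiable_continuous/derivable1_diffP.
  by case: (dF 0).
- by move=> t _; rewrite derive1E; case: (dF t).
Qed.

Lemma integral_expM e : 0 < e ->
  (\int[mu]_(t in `[0%R, +oo[) (expR (- e * t))%:E = (e^-1)%:E)%E.
Proof.
move=> e0; pose F t := - e^-1 * expR (- e * t).
have dF t : is_derive t (1 : R) F (expR (- e * t)).
  rewrite /F; apply: is_derive_eq; rewrite /GRing.scale/=.
  by field; rewrite gt_eqF.
rewrite (ge0_FTC2y (l := 0) _ dF)//.
- by rewrite /F mulr0 expR0 mulr1 sub0r opprK.
- exact: continuous_expM.
- by rewrite -(mulr0 (- e^-1)); apply: cvgMl_tmp; exact: cvgy_expM.
Qed.

Lemma integrable_expM e : 0 < e ->
  mu.-integrable `[0, +oo[ (EFin \o (fun t => expR (- e * t))).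
Proof.
move=> e0; apply/integrableP; split.
  apply/measurable_EFinP; apply: measurable_funTS.
  exact: measurable_expM.
under eq_integral => t _ do rewrite /= ger0_norm ?expR_ge0//.
by rewrite integral_expM// ltry.
Qed.

(** Adding [C * expR (- e * t)] makes the integrand nonnegative, which reduces the
    signed case to [ge0_FTC2y]. *)
Lemma Rintegral_FTC2y_dominated (F f : R -> R) e C : 0 < e ->
  (forall t, is_derive t (1 : R) F (f t)) -> continuous f ->
  (forall t, 0 <= t -> `|f t| <= C * expR (- e * t)) ->
  (forall t, 0 <= t -> `|F t| <= C * expR (- e * t)) ->
  \int[mu]_(t in `[0, +oo[) f t = - F 0.
Proof.
move=> e0 dF cf fC FC.
have iC : mu.-integrable `[0, +oo[ (EFin \o (fun t => C * expR (- e * t))).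
  by apply: integrable_scale => //; exact: integrable_expM.
have if' : mu.-integrable `[0, +oo[ (EFin \o f).
  apply: (integrable_le _ _ iC) => //.
    by apply: measurable_funTS; exact: continuous_measurable_fun.
  by move=> t; rewrite /= in_itv/= andbT; exact: fC.
have -> : \int[mu]_(t in `[0, +oo[) f t =
   \int[mu]_(t in `[0, +oo[) (f t + C * expR (- e * t)) - C * e^-1.
  rewrite RintegralD// RintegralZl//; last exact: integrable_expM.
  by rewrite {3}/Rintegral integral_expM// addrK.
rewrite {1}/Rintegral.
pose G t := F t - C / e * expR (- e * t).
have dG t : is_derive t (1 : R) G (f t + C * expR (- e * t)).
  rewrite /G; apply: is_derive_eq; rewrite /GRing.scale/=.
  by field; rewrite gt_eqF.
rewrite (ge0_FTC2y (l := 0) _ dG)/=.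
- by rewrite /G mulr0 expR0; lra.
- by move=> t /fC; rewrite ler_norml => /andP[+ _]; lra.
- move=> t; apply: cvgD; first exact: cf.
  by apply: cvgMl_tmp; exact: continuous_expM.
rewrite -(subr0 0); apply: cvgB; last first.
  by rewrite -(mulr0 (C / e)); apply: cvgMl_tmp; exact: cvgy_expM.
apply/norm_cvg0P.
apply: (@squeeze_cvgr _ _ _ _ (cst 0) (fun t => C * expR (- e * t))).
- near=> t; rewrite normr_ge0 FC//.
- exact: cvg_cst.
- by rewrite -(mulr0 C); apply: cvgMl_tmp; exact: cvgy_expM.
Unshelve. all: by end_near. Qed.

Lemma Rintegral_exp_cos e y : 0 < e ->
  \int[mu]_(t in `[0, +oo[) (expR (- e * t) * cos (y * t)) = e / (e ^+ 2 + y ^+ 2).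
Proof.
move=> e0; have d0 : 0 < e ^+ 2 + y ^+ 2 by rewrite ltr_pwDl ?exprn_gt0 ?sqr_ge0.
pose C := 1 + (e + `|y|) / (e ^+ 2 + y ^+ 2).
have C1 : 1 <= C by rewrite /C lerDl divr_ge0 ?(ltW d0)// addr_ge0// ltW.
pose F t := expR (- e * t) * (- e * cos (y * t) + y * sin (y * t)) / (e ^+ 2 + y ^+ 2).
have dF t : is_derive t (1 : R) F (expR (- e * t) * cos (y * t)).
  rewrite /F; apply: is_derive_eq; rewrite /GRing.scale/=.
  by field; rewrite gt_eqF.
rewrite (Rintegral_FTC2y_dominated (C := C) e0 dF).
- by rewrite /F !mulr0 expR0 cos0 sin0; ring.
- move=> t; apply: cvgM; first exact: continuous_expM.
  apply: continuous_comp; last exact: continuous_cos.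
  exact: mulrl_continuous.
- move=> t _; rewrite normrM (ger0_norm (expR_ge0 _)) mulrC ler_wpM2r ?expR_ge0//.
  exact: le_trans (cos_max _) C1.
- move=> t _; rewrite /F !normrM (ger0_norm (expR_ge0 _)) -mulrA [leRHS]mulrC.
  rewrite ler_wpM2l ?expR_ge0// /C ler_wpDl// normfV (ger0_norm (ltW d0)).
  rewrite ler_pM2r ?invr_gt0// (le_trans (ler_normD _ _))// !normrM normrN.
  by rewrite (gtr0_norm e0) lerD// ler_piMr ?cos_max ?sin_max// ltW.
Qed.

Lemma Rintegral_exp_sin e y : 0 < e ->
  \int[mu]_(t in `[0, +oo[) (expR (- e * t) * sin (y * t)) = y / (e ^+ 2 + y ^+ 2).
Proof.
move=> e0; have d0 : 0 < e ^+ 2 + y ^+ 2 by rewrite ltr_pwDl ?exprn_gt0 ?sqr_ge0.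
pose C := 1 + (e + `|y|) / (e ^+ 2 + y ^+ 2).
have C1 : 1 <= C by rewrite /C lerDl divr_ge0 ?(ltW d0)// addr_ge0// ltW.
pose F t := expR (- e * t) * (- e * sin (y * t) - y * cos (y * t)) / (e ^+ 2 + y ^+ 2).
have dF t : is_derive t (1 : R) F (expR (- e * t) * sin (y * t)).
  rewrite /F; apply: is_derive_eq; rewrite /GRing.scale/=.
  by field; rewrite gt_eqF.
rewrite (Rintegral_FTC2y_dominated (C := C) e0 dF).
- by rewrite /F !mulr0 expR0 cos0 sin0; ring.
- move=> t; apply: cvgM; first exact: continuous_expM.
  apply: continuous_comp; last exact: continuous_sin.
  exact: mulrl_continuous.
- move=> t _; rewrite normrM (ger0_norm (expR_ge0 _)) mulrC ler_wpM2r ?expR_ge0//.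
  exact: le_trans (sin_max _) C1.
- move=> t _; rewrite /F !normrM (ger0_norm (expR_ge0 _)) -mulrA [leRHS]mulrC.
  rewrite ler_wpM2l ?expR_ge0// /C ler_wpDl// normfV (ger0_norm (ltW d0)).
  rewrite ler_pM2r ?invr_gt0// (le_trans (ler_normB _ _))// !normrM normrN.
  by rewrite (gtr0_norm e0) lerD// ler_piMr ?cos_max ?sin_max// ltW.
Qed.

End damped.

(** * Abel means tested against the Fejér kernel *)

Section abel_fejer.
Context {R : realType}.
Local Notation mu := (@lebesgue_measure R).
Implicit Types (e r x y t : R) (u v : R -> R).

(** The Abel factor. Cutting it off at 0 lets every integral in [t] run over the
    whole line, where Fubini's theorem and the reflection are available. *)
Definition damp e t : R := expR (- e * t) * \1_(`[0, +oo[%classic : set R) t.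

Lemma damp_ge0 e t : 0 <= damp e t.
Proof. by rewrite mulr_ge0 ?expR_ge0. Qed.

Lemma damp_le1 e t : 0 < e -> damp e t <= 1.
Proof.
move=> e0; rewrite /damp indicE; have [|_] := boolP (t \in _); last by rewrite mulr0.
rewrite inE/= in_itv/= andbT => t0.
by rewrite mulr1 expR_le1 mulNr oppr_le0 mulr_ge0// ltW.
Qed.

Lemma measurable_damp e : measurable_fun setT (damp e).
Proof. by apply: measurable_funM => //; exact: measurable_expM. Qed.

Lemma dampE e (f : R -> R) :
  \int[mu]_(t in `[0, +oo[) (expR (- e * t) * f t) = \int[mu]_t (damp e t * f t).
Proof.
rewrite Rintegral_mkcond; apply: eq_Rintegral => t _.
rewrite patchE /damp indicE; case: ifPn => _; first by rewrite mulr1.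
by rewrite mulr0 mul0r.
Qed.

Lemma integrable_damp e : 0 < e -> mu.-integrable setT (EFin \o damp e).
Proof.
move=> e0; have := integrable_expM e0.
rewrite integrable_mkcond//; apply: eq_integrable => // t _.
rewrite /= patchE /damp indicE; case: ifPn => _; first by rewrite mulr1.
by rewrite mulr0.
Qed.

(** The real part at [e + i y] of the Laplace transform of [u + i v]. Since
    [v - i u] is [- i (u + i v)], the imaginary part is [laplace_re v (\- u) e y],
    so one real definition serves for both. *)
Definition laplace_re u v e y : R :=
  \int[mu]_t (damp e t * (u t * cos (y * t) + v t * sin (y * t))).

Section bounded.
Variables (u v : R -> R) (M : R).
Hypotheses (mu_ : measurable_fun setT u) (mv : measurable_fun setT v).
Hypotheses (uM : forall t, `|u t| <= M) (vM : forall t, `|v t| <= M).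

Let M0 : 0 <= M. Proof. exact: le_trans (uM 0). Qed.

Lemma norm_rotation_le (a b c s : R) : `|a| <= M -> `|b| <= M ->
  `|c| <= 1 -> `|s| <= 1 -> `|a * c + b * s| <= 2 * M.
Proof.
move=> aM bM c1 s1; rewrite (le_trans (ler_normD _ _))// !normrM.
have := ler_pM (normr_ge0 _) (normr_ge0 _) aM c1.
have := ler_pM (normr_ge0 _) (normr_ge0 _) bM s1.
lra.
Qed.

Lemma integrable_damp_rotation e (c s : R -> R) : 0 < e ->
  measurable_fun setT c -> measurable_fun setT s ->
  (forall t, `|c t| <= 1) -> (forall t, `|s t| <= 1) ->
  mu.-integrable setT (EFin \o (fun t => damp e t * (u t * c t + v t * s t))).
Proof.
move=> e0 mc ms c1 s1.
have i2 : mu.-integrable setT (EFin \o (fun t => (2 * M) * damp e t)).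
  by apply: integrable_scale => //; exact: integrable_damp.
apply: (integrable_le _ _ i2) => //.
  apply: measurable_funM; first exact: measurable_damp.
  by apply: measurable_funD; apply: measurable_funM.
move=> t _; rewrite normrM (ger0_norm (damp_ge0 _ _)) mulrC ler_wpM2r ?damp_ge0//.
exact: norm_rotation_le.
Qed.

Let measurable_rotation (z : R * R -> R) (f : R -> R) : measurable_fun setT z ->
  continuous f -> measurable_fun setT (fun p => f (z p)).
Proof.
move=> mz cf; apply: measurableT_comp => //; exact: continuous_measurable_fun.
Qed.

Lemma measurable_laplace_re e : 0 < e -> measurable_fun setT (laplace_re u v e).
Proof.
move=> e0.
have := @measurable_parametric_Rintegral _ _ _ _ _ mu
  (fun z : R * R => damp e z.2 * (u z.2 * cos (z.1 * z.2) + v z.2 * sin (z.1 * z.2)))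
  (cst (2 * M)) (damp e).
apply => //.
- apply: measurable_funM.
    by apply: measurableT_comp => //; exact: measurable_damp.
  have mz : measurable_fun setT (fun z : R * R => z.1 * z.2) by exact: measurable_funM.
  apply: measurable_funD; apply: measurable_funM => //; try exact: measurableT_comp.
    by apply: measurable_rotation => //; exact: continuous_cos.
  by apply: measurable_rotation => //; exact: continuous_sin.
- exact: integrable_damp.
move=> y t /=; rewrite normrM (ger0_norm (damp_ge0 _ _)) mulrC ler_wpM2r ?damp_ge0//.
by apply: norm_rotation_le => //; [exact: cos_max|exact: sin_max].
Qed.

Lemma laplace_re_le e y : 0 < e -> `|laplace_re u v e y| <= 2 * M * \int[mu]_t damp e t.
Proof.
move=> e0; rewrite -RintegralZl//; last exact: integrable_damp.
have i2 : mu.-integrable setT (EFin \o (fun t => (2 * M) * damp e t)).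
  by apply: integrable_scale => //; exact: integrable_damp.
apply: le_norm_Rintegral_dominated => //.
  apply: measurable_funM; first exact: measurable_damp.
  by apply: measurable_funD; apply: measurable_funM => //;
    [exact: measurable_cosM|exact: measurable_sinM].
move=> t _; rewrite normrM (ger0_norm (damp_ge0 _ _)) mulrC ler_wpM2r ?damp_ge0//.
by apply: norm_rotation_le => //; [exact: cos_max|exact: sin_max].
Qed.

Lemma laplace_reN e y : 0 < e -> laplace_re (\- u) (\- v) e y = - laplace_re u v e y.
Proof.
move=> e0; rewrite -mulN1r /laplace_re -RintegralZl//; last first.
  apply: integrable_damp_rotation => //; try exact: measurable_cosM.
  - exact: measurable_sinM.
  - by move=> t; exact: cos_max.
  - by move=> t; exact: sin_max.
by apply: eq_Rintegral => t _ /=; ring.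
Qed.

End bounded.

(** The Fourier identity behind the theorem: the Abel mean of [u] against the Fejér
    kernel is the integral over [- r, r] of the tent times the real part of
    e^(ixy) G(e + i y), with G the Laplace transform of [u + i v]. By Fubini's theorem
    the inner integral over [y] produces the kernel from the cosine, while the sine
    contributes 0 because the tent is even; this is why [v] occurs on one side only. *)
Lemma fejer_laplace u v M e r x : measurable_fun setT u -> measurable_fun setT v ->
  (forall t, `|u t| <= M) -> (forall t, `|v t| <= M) -> 0 < e -> 0 < r ->
  \int[mu]_t (damp e t * (u t * fejer r (x - t))) =
  \int[mu]_y (tent r y *
    (cos (x * y) * laplace_re u v e y - sin (x * y) * laplace_re v (\- u) e y)).
Proof.
move=> mu_ mv uM vM e0 r0; apply/esym.
have M0 : 0 <= M by exact: le_trans (uM 0).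
have nuM t : `|(\- u) t| <= M by rewrite /= normrN.
have mnu : measurable_fun setT (\- u) by exact: measurable_funN.
pose f (p : R * R) := tent r p.1 * (damp e p.2 *
  (u p.2 * cos ((x - p.2) * p.1) + v p.2 * - sin ((x - p.2) * p.1))).
(* Addition formulas: the rotation by [x * y] turns the angle [y * t] into
   [(x - t) * y]. *)
transitivity (\int[mu]_y \int[mu]_t f (y, t)).
  apply: eq_Rintegral => y _.
  have iP : mu.-integrable setT (EFin \o (fun t =>
      damp e t * (u t * cos (y * t) + v t * sin (y * t)))).
    apply: (integrable_damp_rotation (M := M)) => // [||t|t].
    - exact: measurable_cosM.
    - exact: measurable_sinM.
    - exact: cos_max.
    - exact: sin_max.
  have iQ : mu.-integrable setT (EFin \o (fun t =>
      damp e t * (v t * cos (y * t) + (\- u) t * sin (y * t)))).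
    apply: (integrable_damp_rotation (M := M)) => // [||t|t].
    - exact: measurable_cosM.
    - exact: measurable_sinM.
    - exact: cos_max.
    - exact: sin_max.
  have iP' := integrable_scale (cos (x * y)) measurableT iP.
  have iQ' := integrable_scale (sin (x * y)) measurableT iQ.
  rewrite /laplace_re -!RintegralZl// -RintegralB// -RintegralZl//; last first.
    exact: (integrableB _ iP' iQ').
  apply: eq_Rintegral => t _; rewrite /f/=.
  rewrite mulrBl sinB cosB !(mulrC y); ring.
rewrite (@Rintegral_Fubini _ _ _ _ _ mu mu f (tent r) (fun t => 2 * M * damp e t)); last 4 first.
- have mt : measurable_fun setT (fun p : R * R => damp e p.2).
    by apply: measurableT_comp => //; exact: measurable_damp.
  have mz : measurable_fun setT (fun p : R * R => (x - p.2) * p.1).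
    by apply: measurable_funM => //; exact: measurable_funB.
  apply: measurable_funM.
    by apply: measurableT_comp => //; exact: measurable_tent.
  apply: measurable_funM => //; apply: measurable_funD; apply: measurable_funM => //.
  + exact: measurableT_comp.
  + apply: measurableT_comp mz; exact: continuous_measurable_fun (@continuous_cos R).
  + exact: measurableT_comp.
  + apply: measurable_funN.
    apply: measurableT_comp mz; exact: continuous_measurable_fun (@continuous_sin R).
- exact: integrable_tent (ltW r0).
- by apply: integrable_scale => //; exact: integrable_damp.
- move=> y t; rewrite /f/= normrM (ger0_norm (tent_ge0 _ _)) ler_wpM2l ?tent_ge0//.
  rewrite normrM (ger0_norm (damp_ge0 _ _)) mulrC ler_wpM2r ?damp_ge0//.
  by apply: norm_rotation_le => //; rewrite ?normrN; [exact: cos_max|exact: sin_max].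
apply: eq_Rintegral => t _.
transitivity (\int[mu]_y (damp e t * u t * (tent r y * cos ((x - t) * y)) -
   damp e t * v t * (tent r y * sin ((x - t) * y)))).
  by apply: eq_Rintegral => y _; rewrite /f/=; ring.
have ic : mu.-integrable setT (EFin \o (fun y => tent r y * cos ((x - t) * y))).
  exact: integrable_tent_cos (ltW r0).
have is' : mu.-integrable setT (EFin \o (fun y => tent r y * sin ((x - t) * y))).
  apply: integrable_tent_mul => //; [exact: ltW|exact: measurable_sinM|].
  by move=> y; exact: sin_max.
rewrite RintegralB//; [|exact: integrable_scale..].
rewrite !RintegralZl// Rintegral_tent_sin ?(ltW r0)// mulr0 subr0 -/(fejer _ _).
by rewrite mulrA.
Qed.

End abel_fejer.

(** * Letting the damping tend to zero *)

Section dominated_cvg.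
Context d (T : measurableType d) (R : realType) (mu : {measure set T -> \bar R}).

Lemma Rintegral_dominated_cvg (f_ : nat -> T -> R) (f g : T -> R) :
  (forall n, measurable_fun setT (f_ n)) -> measurable_fun setT f ->
  mu.-integrable setT (EFin \o g) ->
  (forall t, f_ n t @[n --> \oo] --> f t) ->
  (forall n t, `|f_ n t| <= g t) ->
  \int[mu]_t f_ n t @[n --> \oo] --> \int[mu]_t f t.
Proof.
move=> mf_ mf ig f_f f_g.
have if' : mu.-integrable setT (EFin \o f).
  apply: (integrable_le _ _ ig) => // t _.
  apply: (@ler_cvg_to nat \oo _ R (fun n => `|f_ n t|) (cst (g t))).
  - exact: cvg_norm (f_f t).
  - exact: cvg_cst.
  - exact: nearW.
have cE : \forall t \ae mu, setT t -> (f_ n t)%:E @[n --> \oo] --> (f t)%:E.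
  by apply: aeW => t _; apply: cvg_EFin; [exact: nearW|exact: f_f].
have bE : \forall t \ae mu, forall n, setT t -> (`|(f_ n t)%:E| <= (g t)%:E)%E.
  by apply: aeW => t n _; rewrite lee_fin.
have mE_ n : measurable_fun setT (EFin \o f_ n) by exact/measurable_EFinP.
have mE : measurable_fun setT (EFin \o f) by exact/measurable_EFinP.
have [_ _ dct] := dominated_convergence measurableT mE_ mE cE ig bE.
apply: fine_cvg; rewrite fineK; last exact: integrable_fin_num.
exact: dct.
Qed.

End dominated_cvg.

Section kernel.
Context {R : realType}.
Local Notation mu := (@lebesgue_measure R).
Implicit Types (e r x y t M B : R) (u v g : R -> R).

Lemma abel_fejer_le u v M e r x :
  measurable_fun setT u -> measurable_fun setT v ->
  (forall t, `|u t| <= M) -> (forall t, `|v t| <= M) -> 0 < e -> 0 < r ->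
  `|\int[mu]_t (damp e t * (u t * fejer r (x - t)))| <=
  r * \int[mu]_(y in `]- r, r[)
    (`|laplace_re u v e y| + `|laplace_re v (\- u) e y|).
Proof.
move=> mu_ mv uM vM e0 r0; rewrite (fejer_laplace x mu_ mv uM vM e0 r0).
have nuM t : `|(\- u) t| <= M by rewrite /= normrN.
have mnu : measurable_fun setT (\- u) by exact: measurable_funN.
have mP := measurable_laplace_re mu_ mv uM vM e0.
have mQ := measurable_laplace_re mv mnu vM nuM e0.
pose D : set R := `]- r, r[%classic.
pose h y := \1_D y * (`|laplace_re u v e y| + `|laplace_re v (\- u) e y|).
have ih : mu.-integrable setT (EFin \o h).
  pose c := 2 * M * \int[mu]_t damp e t.
  apply: (integrable_le _ _ (integrable_indic_itv (- r) r (c + c))) => //.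
    apply: measurable_funM; first by apply: measurable_indic; rewrite /D.
    by apply: measurable_funD; apply: measurableT_comp.
  move=> y _; rewrite /h !indicE normrM; case: (boolP (y \in D)) => yD.
    rewrite mem_set; last first.
      by move: yD; rewrite inE/= !in_itv/= => /andP[/ltW -> /ltW ->].
    rewrite normr1 mul1r mulr1 ger0_norm ?addr_ge0// lerD//.
      exact: (laplace_re_le mu_ mv uM vM).
    exact: (laplace_re_le mv mnu vM nuM).
  by rewrite normr0 mul0r mulr_ge0// /c; have := normr_ge0 (laplace_re u v e 0);
    have := laplace_re_le mu_ mv uM vM 0 e0; lra.
have -> : \int[mu]_(y in `]- r, r[)
    (`|laplace_re u v e y| + `|laplace_re v (\- u) e y|) = \int[mu]_y h y.
  rewrite Rintegral_mkcond; apply: eq_Rintegral => y _.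
  by rewrite patchE /h indicE /D; case: ifPn => _; rewrite ?mul1r// mul0r.
rewrite -RintegralZl//; apply: le_norm_Rintegral_dominated => //.
- apply: measurable_funM; first exact: measurable_tent.
  apply: measurable_funB; apply: measurable_funM => //.
    exact: measurable_cosM.
  exact: measurable_sinM.
- exact: integrable_scale.
move=> y _; rewrite normrM (ger0_norm (tent_ge0 _ _)) /h indicE.
have [yr|ry] := ltP `|y| r; last first.
  by rewrite tent_out// mul0r !mulr_ge0// ?addr_ge0// ltW.
rewrite mem_set ?mul1r; last by rewrite /D/= in_itv/= -ltr_norml.
apply: ler_pM => //; [exact: tent_ge0|exact: tent_le (ltW r0)|].
rewrite (le_trans (ler_normB _ _))// !normrM.
by rewrite lerD// ler_piMl ?cos_max ?sin_max.
Qed.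

Lemma cvg_damp t : 0 <= t -> damp (n.+1%:R^-1 : R) t @[n --> \oo] --> (1 : R).
Proof.
move=> t0; have -> : (fun n : nat => damp (n.+1%:R^-1 : R) t) =
    (fun n : nat => expR (- t * n.+1%:R^-1)).
  apply/funext => n; rewrite /damp indicE mem_set ?mulr1 ?mulNr 1?mulrC//.
  by rewrite /= in_itv/= andbT.
rewrite [X in _ --> X](_ : 1 = expR (- t * 0)); last by rewrite mulr0 expR0.
apply: (@cvg_comp _ _ _ (fun n : nat => n.+1%:R^-1 : R) (fun e => expR (- t * e))).
  exact: cvg_harmonic.
exact: continuous_expM.
Qed.

(** A bound on Abel means that is uniform in the damping passes to the undamped
    integral by dominated convergence along [e = 1 / n.+1]; [u] has to vanish on the
    negative axis because [damp] does. *)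
Lemma le_norm_Rintegral_damp u g M B : measurable_fun setT u ->
  (forall t, `|u t| <= M) -> (forall t, t < 0 -> u t = 0) ->
  mu.-integrable setT (EFin \o g) ->
  (\forall e \near 0^'+, `|\int[mu]_t (damp e t * (u t * g t))| <= B) ->
  `|\int[mu]_t (u t * g t)| <= B.
Proof.
move=> mu_ uM u0 ig H.
have mg : measurable_fun setT g by have /measurable_EFinP := measurable_int mu ig.
pose s n : R := n.+1%:R^-1.
have M0 : 0 <= M by exact: le_trans (uM 0).
have s0 n : 0 < s n by rewrite invr_gt0.
have dct : \int[mu]_t (damp (s n) t * (u t * g t)) @[n --> \oo] -->
    \int[mu]_t (u t * g t).
  apply: (@Rintegral_dominated_cvg _ (measurableTypeR R) R mu _ _ (fun t => M * `|g t|)).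
  - move=> n; apply: measurable_funM; first exact: measurable_damp.
    exact: measurable_funM.
  - exact: measurable_funM.
  - by apply: integrable_scale => //; exact: (integrable_norm ig).
  - move=> t; have [t0|t0] := leP 0 t.
      by rewrite -[X in _ --> X]mul1r; apply: cvgMr_tmp; exact: cvg_damp.
    under eq_fun do rewrite u0// mul0r mulr0.
    by rewrite u0// mul0r; exact: cvg_cst.
  - move=> n t; rewrite normrM (ger0_norm (damp_ge0 _ _)) normrM mulrA.
    apply: ler_wpM2r; first exact: normr_ge0.
    by rewrite -[leRHS]mul1r ler_pM ?damp_ge0 ?damp_le1.
have sH : \forall n \near \oo, `|\int[mu]_t (damp (s n) t * (u t * g t))| <= B.
  have /cvgrPdist_lt sc := @cvg_harmonic R.
  case: H => d /= d0 H; near=> n; apply: H => //=.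
  by near: n; exact: sc.
exact: (ler_cvg_to (cvg_norm dct) (cvg_cst B) sH).
Unshelve. all: by end_near. Qed.

End kernel.

(** * Smoothing by a probability density *)

Section averages.
Context {R : realType}.
Local Notation mu := (@lebesgue_measure R).
Implicit Types (e r x y z t M B theta eta : R) (u v g k : R -> R).

Definition probability_density k :=
  [/\ forall t, 0 <= k t, mu.-integrable setT (EFin \o k) & \int[mu]_t k t = 1].

(** The property through which the boundary behavior enters both conclusions: some
    probability density makes the convolutions with [u] and with [v] uniformly small.
    The density must be common to both, because an invariant mean is applied to the
    complex function [u + i v]. *)
Definition uniformly_smoothable u v := forall eta, 0 < eta ->
  exists2 k, probability_density k & forall x,
    `|\int[mu]_t (k t * u (x - t))| <= eta /\
    `|\int[mu]_t (k t * v (x - t))| <= eta.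

Lemma integrable_mul_bounded g u M : mu.-integrable setT (EFin \o g) ->
  measurable_fun setT u -> (forall t, `|u t| <= M) ->
  mu.-integrable setT (EFin \o (fun t => g t * u t)).
Proof.
move=> ig mu_ uM.
have mg : measurable_fun setT g by have /measurable_EFinP := measurable_int mu ig.
have i2 : mu.-integrable setT (EFin \o (fun t => M * `|g t|)).
  by apply: integrable_scale => //; exact: (integrable_norm ig).
apply: (integrable_le _ _ i2) => //; first exact: measurable_funM.
by move=> t _; rewrite normrM mulrC ler_wpM2r.
Qed.

Lemma Rintegral_convC g u M x : mu.-integrable setT (EFin \o g) ->
  measurable_fun setT u -> (forall t, `|u t| <= M) ->
  \int[mu]_t (u t * g (x - t)) = \int[mu]_t (g t * u (x - t)).
Proof.
move=> ig mu_ uM.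
have := @Rintegral_rsub R x (fun t => g (x - t) * u t).
under eq_Rintegral do rewrite subKr.
move=> ->.
  by apply: eq_Rintegral => t _; rewrite mulrC.
apply: integrable_mul_bounded uM => //; exact: (integrable_rsub x ig).
Qed.

(** The density is the normalized Fejér kernel. By [abel_fejer_le] its Abel means are
    at most [r * (eta * c)], and by [fejer_mass] the normalization divides by at least
    [c * r]. The bound for [v] comes from the pair [(v, - u)], whose transform has the
    same modulus. *)
Lemma laplace_re_smoothable u v M :
  measurable_fun setT u -> measurable_fun setT v ->
  (forall t, `|u t| <= M) -> (forall t, `|v t| <= M) ->
  (forall t, t < 0 -> u t = 0) -> (forall t, t < 0 -> v t = 0) ->
  (forall eta, 0 < eta -> exists2 r, 0 < r & \forall e \near 0^'+,
     \int[mu]_(y in `]- r, r[)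
       (`|laplace_re u v e y| + `|laplace_re v (\- u) e y|) <= eta) ->
  uniformly_smoothable u v.
Proof.
move=> mu_ mv uM vM u0 v0 H eta eta0.
pose c : R := cos (1 / 2) / 2.
have c0 : 0 < c.
  rewrite divr_gt0//; apply: cos_gt0_pihalf; have := pihalf_ge1 R.
  by move=> ?; apply/andP; split; lra.
have [r r0 Hr] := H _ (mulr_gt0 eta0 c0).
have mass := fejer_mass r0; rewrite -/c in mass.
pose m := \int[mu]_z fejer r z.
have m0 : 0 < m by exact: lt_le_trans (mulr_gt0 c0 r0) mass.
have nuM t : `|(\- u) t| <= M by rewrite /= normrN.
have mnu : measurable_fun setT (\- u) by exact: measurable_funN.
have ifx x : mu.-integrable setT (EFin \o (fun t => fejer r (x - t))).
  exact: (integrable_rsub x (integrable_fejer r0)).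
have small (w : R -> R) : measurable_fun setT w -> (forall t, `|w t| <= M) ->
    (forall x, `|\int[mu]_t (w t * fejer r (x - t))| <= r * (eta * c)) ->
    forall x, `|\int[mu]_t (m^-1 * fejer r t * w (x - t))| <= eta.
  move=> mw wM Hw x; under eq_Rintegral do rewrite -mulrA.
  have mwx : measurable_fun setT (fun t => w (x - t)).
    exact: (measurableT_comp mw (measurable_rsub x)).
  rewrite RintegralZl//; last first.
    exact: (integrable_mul_bounded (integrable_fejer r0) mwx (fun t => wM (x - t))).
  rewrite -(Rintegral_convC x (integrable_fejer r0) mw wM).
  rewrite normrM gtr0_norm ?invr_gt0// mulrC ler_pdivrMr//.
  by rewrite (le_trans (Hw x))// mulrCA ler_wpM2l ?(ltW eta0)// mulrC.
exists (fun t => m^-1 * fejer r t).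
  split; first by move=> t; rewrite mulr_ge0 ?fejer_ge0// invr_ge0 ltW.
  - by apply: integrable_scale => //; exact: integrable_fejer.
  - by rewrite RintegralZl ?mulVf ?gt_eqF//; exact: integrable_fejer.
move=> x; split; apply: small => //.
  move=> {}x; apply: (le_norm_Rintegral_damp mu_ uM u0 (ifx x)).
  near=> e; apply: (le_trans (abel_fejer_le x mu_ mv uM vM _ r0)).
    by near: e; exact: nbhs_right_gt.
  by rewrite ler_pM2l//; near: e.
move=> {}x; apply: (le_norm_Rintegral_damp mv vM v0 (ifx x)).
near=> e; apply: (le_trans (abel_fejer_le x mv mnu vM nuM _ r0)).
  by near: e; exact: nbhs_right_gt.
have e0 : 0 < e by near: e; exact: nbhs_right_gt.
rewrite ler_pM2l//.
under eq_Rintegral do rewrite (laplace_reN mu_ mv uM vM)// normrN addrC.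
by near: e.
Unshelve. all: by end_near. Qed.

Lemma integrable_shift g t : mu.-integrable setT (EFin \o g) ->
  mu.-integrable setT (EFin \o (fun z => g (z + t))).
Proof.
move=> ig; have := integrable_rsub 0 (integrable_rsub t ig).
by under eq_fun do rewrite sub0r opprK addrC.
Qed.

Lemma Rintegral_shift g t : mu.-integrable setT (EFin \o g) ->
  \int[mu]_z g (z + t) = \int[mu]_z g z.
Proof.
move=> ig; rewrite -(Rintegral_rsub t ig) -[RHS](Rintegral_rsub 0).
  by apply: eq_Rintegral => z _; rewrite sub0r opprK addrC.
exact: (integrable_rsub t ig).
Qed.

Lemma Rintegral_indic_mul (a b : R) g :
  \int[mu]_(z in `[a, b]) g z = \int[mu]_z (\1_(`[a, b]%classic : set R) z * g z).
Proof.
rewrite Rintegral_mkcond; apply: eq_Rintegral => z _.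
by rewrite patchE indicE; case: ifPn => _; rewrite ?mul1r// mul0r.
Qed.

Lemma integrable_indic_mul (a b : R) u M :
  measurable_fun setT u -> (forall t, `|u t| <= M) ->
  mu.-integrable setT (EFin \o (fun t => \1_(`[a, b]%classic : set R) t * u t)).
Proof.
move=> mu_ uM; apply: (integrable_mul_bounded _ mu_ uM).
exact: integrable_indic1_itv.
Qed.

Lemma norm_Rintegral_itv_le (a b : R) u M : a <= b ->
  measurable_fun setT u -> (forall t, `|u t| <= M) ->
  `|\int[mu]_(z in `[a, b]) u z| <= M * (b - a).
Proof.
move=> ab mu_ uM; rewrite Rintegral_indic_mul -Rintegral_indic_itv//.
apply: le_norm_Rintegral_dominated => //.
- by apply: measurable_funM => //; exact: measurable_indic.
- exact: integrable_indic_itv.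
by move=> z _; rewrite normrM mulrC (ger0_norm (_ : 0 <= \1__ _))// ler_wpM2r.
Qed.

(** The indicators of an interval and of its translate by [t] differ only within
    distance [`|t|] of the two end points. The bound by [theta] matters for large [t]:
    the Fejér kernel has no first moment, so [`|t|] alone could not be integrated
    against it. *)
Lemma norm_Rintegral_shift_le u M x theta t : 0 <= theta ->
  measurable_fun setT u -> (forall t, `|u t| <= M) ->
  `|\int[mu]_(z in `[x, x + theta]) u (z - t) - \int[mu]_(z in `[x, x + theta]) u z|
    <= 4 * M * Num.min `|t| theta.
Proof.
move=> th0 mu_ uM; have M0 : 0 <= M by exact: le_trans (uM 0).
have mut : measurable_fun setT (fun z => u (z - t)).
  by apply: measurableT_comp => //; exact: measurable_funB.
have [tt|tt] := leP `|t| theta; last first.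
  have := @norm_Rintegral_itv_le x (x + theta) _ M _ mut (fun z => uM (z - t)).
  have := @norm_Rintegral_itv_le x (x + theta) _ M _ mu_ uM.
  rewrite !lerDl => /(_ th0) h1 /(_ th0) h2.
  by apply: (le_trans (ler_normB _ _)); nra.
rewrite !Rintegral_indic_mul.
pose I z : R := \1_(`[x, x + theta]%classic : set R) z.
have -> : \int[mu]_z (\1_(`[x, x + theta]%classic : set R) z * u (z - t)) =
   \int[mu]_z (I (z + t) * u z).
  rewrite -(Rintegral_shift t); last exact: (integrable_indic_mul _ _ mut).
  by apply: eq_Rintegral => z _; rewrite addrK.
have i1 : mu.-integrable setT (EFin \o (fun z => I (z + t) * u z)).
  have := integrable_shift t (integrable_indic_mul x (x + theta) mut (fun z => uM (z - t))).
  by under eq_fun do rewrite /= addrK.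
have i2 : mu.-integrable setT (EFin \o (fun z => I z * u z)).
  exact: (integrable_indic_mul _ _ mu_).
rewrite -RintegralB//.
pose J1 := `[x - `|t|, x + `|t|]%classic : set R.
pose J2 := `[x + theta - `|t|, x + theta + `|t|]%classic : set R.
have t0 := normr_ge0 t.
have iJ1 : mu.-integrable setT (EFin \o (fun z => M * \1_J1 z))
  by exact: integrable_indic_itv.
have iJ2 : mu.-integrable setT (EFin \o (fun z => M * \1_J2 z))
  by exact: integrable_indic_itv.
apply: (@le_trans _ _ (\int[mu]_z (M * \1_J1 z + M * \1_J2 z))); last first.
  by rewrite RintegralD// !Rintegral_indic_itv; nra.
apply: le_norm_Rintegral_dominated => //.
- by have /measurable_EFinP := measurable_int mu (integrableB measurableT i1 i2).
- exact: (integrableD measurableT iJ1 iJ2).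
move=> z _; rewrite -mulrBl normrM mulrC -mulrDr ler_pM// /I.
have [zJ|] := boolP ((z \in J1) || (z \in J2)).
  apply: (@le_trans _ _ 1).
    rewrite !indicE; case: (_ \in _); case: (_ \in _);
    by rewrite ?subr0 ?sub0r ?subrr ?normrN ?normr1 ?normr0.
  by move: zJ; rewrite !indicE; case: (_ \in _); case: (_ \in _) => //= _; lra.
rewrite negb_or /J1 /J2 !mem_setE !in_itv/= => /andP[n1 n2].
have [ta tb] : - `|t| <= t /\ t <= `|t| by rewrite ler_norm lerNl -normrN ler_norm.
rewrite !indicE (_ : (z + t \in _) = (z \in `[x, x + theta]%classic)).
  by rewrite subrr normr0 addr_ge0.
by apply/idP/idP; rewrite !mem_setE !in_itv/=; lra.
Qed.

End averages.

(** * Averages over long intervals *)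

Section uniform_averages.
Context {R : realType}.
Local Notation mu := (@lebesgue_measure R).
Implicit Types (x y z t M theta eta : R) (u g k : R -> R).

Lemma measurable_convolution k u M : mu.-integrable setT (EFin \o k) ->
  (forall t, 0 <= k t) ->
  measurable_fun setT u -> (forall t, `|u t| <= M) ->
  measurable_fun setT (fun x => \int[mu]_t (k t * u (x - t))).
Proof.
move=> ik k0 mu_ uM.
have mk : measurable_fun setT k by have /measurable_EFinP := measurable_int mu ik.
have := @measurable_parametric_Rintegral _ _ _ _ _ mu
  (fun z : R * R => k z.2 * u (z.1 - z.2)) (cst M) k.
apply => //.
  apply: measurable_funM; first exact: measurableT_comp.
  by apply: measurableT_comp => //; exact: measurable_funB.
by move=> x t /=; rewrite normrM (ger0_norm (k0 _)) mulrC ler_wpM2r.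
Qed.

Lemma Rintegral_itv_convolution k u M (a b : R) :
  mu.-integrable setT (EFin \o k) -> (forall t, 0 <= k t) ->
  measurable_fun setT u -> (forall t, `|u t| <= M) ->
  \int[mu]_(z in `[a, b]) \int[mu]_t (k t * u (z - t)) =
  \int[mu]_t (k t * \int[mu]_(z in `[a, b]) u (z - t)).
Proof.
move=> ik k0 mu_ uM.
have mk : measurable_fun setT k by have /measurable_EFinP := measurable_int mu ik.
have ms t : measurable_fun setT (fun z => u (z - t)).
  by apply: measurableT_comp => //; exact: measurable_funB.
have mr z : measurable_fun setT (fun t => u (z - t)).
  exact: (measurableT_comp mu_ (measurable_rsub z)).
pose I : R -> R := \1_(`[a, b]%classic : set R).
pose f (p : R * R) : R := I p.1 * (k p.2 * u (p.1 - p.2)).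
have i1 : mu.-integrable setT (EFin \o I) by exact: integrable_indic1_itv.
transitivity (\int[mu]_z \int[mu]_t f (z, t)).
  rewrite Rintegral_indic_mul; apply: eq_Rintegral => z _.
  rewrite -RintegralZl//.
  exact: (integrable_mul_bounded ik (mr z) (fun t => uM (z - t))).
rewrite (@Rintegral_Fubini _ _ _ _ _ mu mu f I (fun t => M * k t))//.
- apply: eq_Rintegral => t _.
  rewrite Rintegral_indic_mul -RintegralZl//; last first.
    exact: (integrable_indic_mul a b (ms t) (fun z => uM (z - t))).
  by apply: eq_Rintegral => z _; rewrite /f/= mulrCA.
- apply: measurable_funM.
    by apply: measurableT_comp => //; exact: measurable_indic.
  apply: measurable_funM; first exact: measurableT_comp.
  by apply: measurableT_comp => //; exact: measurable_funB.
- exact: integrable_scale.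
move=> z t; rewrite /f/= normrM (ger0_norm (_ : 0 <= \1__ _))// ler_wpM2l//.
by rewrite normrM (ger0_norm (k0 _)) mulrC ler_wpM2r.
Qed.

(** Dominated convergence: the truncated quotients tend to 0 pointwise, and the
    truncation at 1 keeps [k] times a constant as a majorant. *)
Lemma cvg_density_min k (c : R) : mu.-integrable setT (EFin \o k) -> (forall t, 0 <= k t) ->
  \int[mu]_t (k t * (c * Num.min (`|t| / n.+1%:R) 1)) @[n --> \oo] --> (0 : R).
Proof.
move=> ik k0.
have mk : measurable_fun setT k by have /measurable_EFinP := measurable_int mu ik.
have min0 (n : nat) t : 0 <= Num.min (`|t| / n.+1%:R) 1.
  by rewrite le_min divr_ge0//=.
have -> : (0 : R) = \int[mu]_t (cst 0 t) by rewrite /Rintegral integral0.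
apply: (@Rintegral_dominated_cvg _ (measurableTypeR R) R mu _ _ (fun t => `|c| * k t)).
- move=> n; apply: measurable_funM => //; apply: measurable_funM => //.
  apply: measurable_minr => //; apply: measurable_funM => //.
- exact: measurable_cst.
- exact: integrable_scale.
- move=> t; rewrite -(mulr0 (k t)); apply: cvgMl_tmp.
  rewrite -[X in _ --> X](mulr0 c); apply: cvgMl_tmp.
  apply: (@squeeze_cvgr _ _ _ _ (cst 0) (fun n : nat => `|t| * n.+1%:R^-1)).
  + by apply: nearW => n; rewrite min0/= ge_min lexx.
  + exact: cvg_cst.
  + by rewrite -(mulr0 `|t|); apply: cvgMl_tmp; exact: cvg_harmonic.
- move=> n t; rewrite normrM (ger0_norm (k0 t)) mulrC; apply: ler_wpM2r => //.
  by rewrite normrM (ger0_norm (min0 n t)) ler_piMr// ge_min lexx orbT.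
Qed.

(** The average of [u] over [x, x + theta] is compared with that of the convolution
    [k * u], which is at most [eta / 2]. By Fubini's theorem the difference is a [k]-mean
    of the effect of translating the interval, so [norm_Rintegral_shift_le] and
    [cvg_density_min] make it small relative to [theta], uniformly in [x]. *)
Lemma smoothable_average u M : measurable_fun setT u -> (forall t, `|u t| <= M) ->
  (forall eta, 0 < eta -> exists2 k, probability_density k &
     forall x, `|\int[mu]_t (k t * u (x - t))| <= eta) ->
  forall eta, 0 < eta -> exists2 theta0, 0 < theta0 &
    forall theta x, theta0 <= theta ->
      `|\int[mu]_(z in `[x, x + theta]) u z| <= theta * eta.
Proof.
move=> mu_ uM H eta eta0; have M0 : 0 <= M by exact: le_trans (uM 0).
have eta2 : 0 < eta / 2 by rewrite divr_gt0.
have [k [k0 ik k1] Hk] := H _ eta2.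
have mk : measurable_fun setT k by have /measurable_EFinP := measurable_int mu ik.
have [N _ HN] := cvgr_le _ (cvg_density_min (4 * M) ik k0) _ eta2.
have {HN}/= := HN N (leqnn N); set L := (X in X <= _) => HL.
have N0 : 0 < N.+1%:R :> R by [].
exists N.+1%:R => // theta x thN.
have th0 : 0 < theta by exact: lt_le_trans thN.
pose I : R -> R := \1_(`[x, x + theta]%classic : set R).
pose S t := \int[mu]_(z in `[x, x + theta]) u (z - t).
pose S0 := \int[mu]_(z in `[x, x + theta]) u z.
have xt : x <= x + theta by rewrite lerDl ltW.
have lenI : x + theta - x = theta by rewrite addrAC subrr add0r.
have SM t : `|S t| <= M * theta.
  have := @norm_Rintegral_itv_le R x (x + theta) (fun z => u (z - t)) M xt _
    (fun z => uM (z - t)).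
  rewrite lenI; apply.
  by apply: measurableT_comp => //; exact: measurable_funB.
have mS : measurable_fun setT S.
  have := @measurable_parametric_Rintegral _ _ _ _ _ mu
    (fun p : R * R => I p.2 * u (p.2 - p.1)) (cst M) I.
  rewrite (_ : S = (fun t => \int[mu]_z (I z * u (z - t)))).
    apply => //.
    - apply: measurable_funM.
        by apply: measurableT_comp => //; exact: measurable_indic.
      by apply: measurableT_comp => //; exact: measurable_funB.
    - exact: integrable_indic1_itv.
    move=> t z /=; rewrite normrM mulrC (ger0_norm (_ : 0 <= \1__ _))//.
    by rewrite ler_wpM2r.
  by apply/funext => t; rewrite /S Rintegral_indic_mul.
have ikS := integrable_mul_bounded ik mS SM.
have conv_le : `|\int[mu]_t (k t * S t)| <= eta / 2 * theta.
  rewrite -(Rintegral_itv_convolution _ _ ik k0 mu_ uM).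
  have := norm_Rintegral_itv_le xt (measurable_convolution ik k0 mu_ uM) Hk.
  by rewrite lenI.
have iS0 : mu.-integrable setT (EFin \o (fun t => S0 * k t)) by exact: integrable_scale.
have diff_le : `|\int[mu]_t (k t * S t) - S0| <= theta * L.
  have -> : S0 = \int[mu]_t (S0 * k t) by rewrite RintegralZl// k1 mulr1.
  rewrite -RintegralB//.
  have iL : mu.-integrable setT
      (EFin \o (fun t => k t * (4 * M * Num.min (`|t| / N.+1%:R) 1))).
    apply: (integrable_mul_bounded (M := 4 * M) ik).
      apply: measurable_funM => //.
      by apply: measurable_minr => //; apply: measurable_funM.
    move=> t; have m0 : 0 <= Num.min (`|t| / N.+1%:R) 1 by rewrite le_min divr_ge0/=.
    by rewrite ger0_norm ?mulr_ge0// ler_piMr ?mulr_ge0// ge_min lexx orbT.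
  rewrite /L -RintegralZl//; apply: le_norm_Rintegral_dominated => //.
  - by have /measurable_EFinP := measurable_int mu (integrableB measurableT ikS iS0).
  - exact: integrable_scale.
  move=> t _; rewrite [S0 * _]mulrC -mulrBr normrM (ger0_norm (k0 t)) mulrCA.
  apply: ler_wpM2l => //.
  apply: (le_trans (norm_Rintegral_shift_le x t (ltW th0) mu_ uM)).
  rewrite mulrCA; apply: ler_wpM2l; first by rewrite mulr_ge0.
  rewrite minr_pMr ?(ltW th0)// mulr1 le_min ge_min [X in _ && X]ge_min lexx orbT andbT.
  by rewrite mulrA [theta * _]mulrC -mulrA ler_peMr// ler_pdivlMr ?mul1r.
rewrite -/S0; have -> : S0 = \int[mu]_t (k t * S t) - (\int[mu]_t (k t * S t) - S0).
  by rewrite opprB addrC subrK.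
rewrite (le_trans (ler_normB _ _))//.
have : theta * L <= theta * (eta / 2) by rewrite ler_pM2l.
lra.
Qed.

End uniform_averages.

(** * Topologically invariant means *)

Section means.
Context {R : realType}.
Local Notation mu := (@lebesgue_measure R).
Implicit Types (x t M B : R) (u v k : R -> R) (f : R -> R[i]).

Lemma ae_imp (P Q : R -> Prop) : (forall x, P x -> Q x) ->
  (\forall x \ae mu, P x) -> \forall x \ae mu, Q x.
Proof. by move=> PQ; apply: filterS => //; exact: (ae_filter_ringOfSetsType mu). Qed.

Lemma normc_ge0 (z : R[i]) : 0 <= normc z.
Proof. by case: z => a b; exact: sqrtr_ge0. Qed.

Lemma normc_le_Re_Im (z : R[i]) : normc z <= `|complex.Re z| + `|complex.Im z|.
Proof.
case: z => a b /=; rewrite -[leRHS]ger0_norm ?addr_ge0// -sqrtr_sqr ler_wsqrtr//.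
rewrite -(real_normK (num_real a)) -(real_normK (num_real b)).
by have := mulr_ge0 (normr_ge0 a) (normr_ge0 b); rewrite sqrrD; lra.
Qed.

Lemma Re_le_normc (z : R[i]) : `|complex.Re z| <= normc z.
Proof.
by case: z => a b /=; rewrite -sqrtr_sqr ler_wsqrtr// lerDl sqr_ge0.
Qed.

Lemma Im_le_normc (z : R[i]) : `|complex.Im z| <= normc z.
Proof.
by case: z => a b /=; rewrite -sqrtr_sqr ler_wsqrtr// lerDr sqr_ge0.
Qed.

Lemma Linfty_norm_le f B : (\forall x \ae mu, normc (f x) <= B) ->
  (Linfty_norm setT f <= B%:E)%E.
Proof.
move=> fB; apply/ess_supP; move: fB; apply: ae_imp => x; rewrite /= patchE in_setT.
by rewrite lee_fin.
Qed.

Lemma Linfty_norm_ge0 f : (0 <= Linfty_norm setT f)%E.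
Proof.
have muT : (0 < mu `]-oo, +oo[%classic)%E by rewrite lebesgue_measure_itv/= ltry.
rewrite set_itvNyy in muT; apply: ess_sup_ger => //.
by move=> x; rewrite /= patchE in_setT lee_fin normc_ge0.
Qed.

Lemma Linfty_bounded f B : cmeasurable setT f ->
  (\forall x \ae mu, normc (f x) <= B) -> Linfty setT f.
Proof. by move=> mf fB; split => //; exact: le_lt_trans (Linfty_norm_le fB) (ltry _). Qed.

(** Restating boundedness with a nonnegative constant and an almost everywhere bound
    avoids extended-real products with an unsigned constant. *)
Lemma Linfty_dual_bound phi : Linfty_dual phi -> exists2 C : R, 0 <= C &
  forall f B, cmeasurable setT f -> (\forall x \ae mu, normc (f x) <= B) ->
    normc (phi f) <= C * B.
Proof.
move=> [_ [C HC]]; exists `|C| => // f B mf fB.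
have Lf := Linfty_bounded mf fB.
rewrite -lee_fin (le_trans (HC _ Lf))//.
apply: (@le_trans _ _ (`|C|%:E * Linfty_norm setT f)%E).
  by apply: lee_wpmul2r; [exact: Linfty_norm_ge0|rewrite lee_fin ler_norm].
by rewrite EFinM; apply: lee_wpmul2l; [rewrite lee_fin|exact: Linfty_norm_le].
Qed.

Lemma Rintegral0 : \int[mu]_(t in setT) (0 : R) = 0.
Proof. by rewrite /Rintegral integral0. Qed.

Lemma density_L1 k : probability_density k ->
  [/\ L1 setT (fun t => (k t)%:C), (\forall x \ae mu, 0 <= (k x)%:C) &
      cintegral setT (fun t => (k t)%:C) = 1].
Proof.
move=> [k0 ik k1].
have mk : measurable_fun setT k by have /measurable_EFinP := measurable_int mu ik.
split.
- split; first by split => //=; exact: measurable_cst.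
  have := integrable_lty measurableT (integrable_norm ik).
  under eq_integral do rewrite /= -[`|_|]sqrtr_sqr -[_ ^+ 2]addr0 -[0](expr0n R 2).
  by [].
- by apply: aeW => x; rewrite lecE/= eqxx k0.
- by rewrite /cintegral/= k1 Rintegral0.
Qed.

Lemma convolution_density k u v x :
  convolution (fun t => (k t)%:C) (fun t => u t +i* v t) x =
  (\int[mu]_t (k t * u (x - t))) +i* (\int[mu]_t (k t * v (x - t))).
Proof.
by rewrite /convolution /cintegral; congr (_ +i* _); apply: eq_Rintegral => t _ /=;
  rewrite mul0r ?subr0 ?addr0.
Qed.

(** Invariance replaces [u + i v] by its convolution with a density, which is
    uniformly small, and the mean is bounded. *)
Lemma smoothable_mean0 phi u v M : Linfty_dual phi -> topologically_invariant phi ->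
  measurable_fun setT u -> measurable_fun setT v ->
  (forall t, `|u t| <= M) -> (forall t, `|v t| <= M) ->
  uniformly_smoothable u v -> phi (fun t => u t +i* v t) = 0.
Proof.
move=> dphi iphi mu_ mv uM vM H.
pose w t := u t +i* v t.
have Lw : Linfty setT w.
  apply: (@Linfty_bounded _ (M + M)) => //; apply: aeW => t.
  by rewrite (le_trans (normc_le_Re_Im _))//= lerD.
have [C C0 HC] := Linfty_dual_bound dphi.
apply: eq0_normc; apply/eqP; rewrite eq_le normc_ge0 andbT.
apply/ler_addgt0Pr => eta eta0; rewrite add0r.
have C1 : 0 < 2 * (C + 1) by rewrite mulr_gt0// ltr_pwDr.
have [k [k0 ik k1] Hk] := H _ (divr_gt0 eta0 C1).
have [L1k ak Ik] := density_L1 (And3 k0 ik k1).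
rewrite -(iphi w _ Lw L1k ak Ik).
have := HC (convolution (fun t => (k t)%:C) w) (eta / (2 * (C + 1)) + eta / (2 * (C + 1))).
move=> /(_ _ _)/le_trans; apply.
- rewrite (_ : convolution _ _ = fun x => (\int[mu]_t (k t * u (x - t))) +i*
      (\int[mu]_t (k t * v (x - t)))); last first.
    by apply/funext => x; exact: convolution_density.
  by split => /=; exact: (measurable_convolution ik k0).
- apply: aeW => x; rewrite convolution_density.
  have [h1 h2] := Hk x.
  by rewrite (le_trans (normc_le_Re_Im _))//= lerD.
have -> : eta / (2 * (C + 1)) + eta / (2 * (C + 1)) = eta / (C + 1).
  by field; rewrite gt_eqF// ltr_pwDr.
rewrite mulrCA ger_pMr// ler_pdivrMr ?mul1r ?ltr_pwDr//.
by rewrite lerDl.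
Qed.

End means.

(** * The complex Laplace transform in real coordinates *)

Section assembly.
Context {R : realType}.
Local Notation mu := (@lebesgue_measure R).
Local Notation nonneg := (`[0, +oo[%classic : set R).
Implicit Types (e x y t M B a b eta : R) (u v p q k : R -> R) (f psi : R -> R[i]).

Lemma uniform_cvg_normc (F : R -> R -> R[i]) (A : set R) (alpha : R[i]) :
  (forall eta, 0 < eta -> exists theta0 : R, forall theta x, theta0 <= theta -> A x ->
     normc (F theta x - alpha) <= eta) ->
  {uniform A, (fun theta x : R => F theta x : R[i]^o) @ +oo --> cst (alpha : R[i]^o)}.
Proof.
move=> H P /uniform_nbhs[E [entE EP]].
move: entE; rewrite -entourage_ballE => -[/= eps eps0 epsE].
have /andP[/eqP eim ere] : (complex.Im eps == 0) && (0 < complex.Re eps).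
  by move: eps0; rewrite ltcE/= eq_sym.
have [theta0 H0] := H _ (divr_gt0 ere (ltr0n R 2)).
near=> theta; apply: EP => x Ax; apply: epsE => /=.
rewrite -ball_normE/= -normrN opprB.
rewrite ltcE/= eim eqxx/=.
apply: le_lt_trans (H0 theta x _ Ax) _; last by rewrite ltr_pdivrMr// ltr_pMr// ltr1n.
by near: theta; exact: nbhs_pinfty_ge (num_real _).
Unshelve. all: by end_near. Qed.

Lemma measurable_normc (D : set R) f : measurable D -> cmeasurable D f ->
  measurable_fun D (fun x => normc (f x)).
Proof.
move=> mD [mre mim].
have -> : (fun x => normc (f x)) =
  (fun x => Num.sqrt (complex.Re (f x) ^+ 2 + complex.Im (f x) ^+ 2)).
  by apply/funext => x; case: (f x).
apply: measurableT_comp; first exact: continuous_measurable_fun (@sqrt_continuous R).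
by apply: measurable_funD; exact: measurable_funX.
Qed.

Lemma Rintegral_ae_eq (D : set R) p q : measurable D ->
  measurable_fun D p -> measurable_fun D q ->
  (\forall t \ae mu, D t -> p t = q t) ->
  \int[mu]_(t in D) p t = \int[mu]_(t in D) q t.
Proof.
move=> mD mp mq pq; rewrite /Rintegral; congr fine; apply: ae_eq_integral => //.
- exact/measurable_EFinP.
- exact/measurable_EFinP.
- by move: pq; apply: ae_imp => t pq Dt; rewrite pq.
Qed.

(** The constants [a] and [b] contribute the transforms of cosine and sine, that is,
    the real part of [(a + i b) / (e + i y)]. *)
Lemma Rintegral_laplace p q u v M a b e y : 0 < e ->
  measurable_fun nonneg p -> measurable_fun nonneg q ->
  measurable_fun setT u -> measurable_fun setT v ->
  (forall t, `|u t| <= M) -> (forall t, `|v t| <= M) ->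
  (\forall t \ae mu, nonneg t -> p t = u t + a) ->
  (\forall t \ae mu, nonneg t -> q t = v t + b) ->
  \int[mu]_(t in `[0, +oo[) (expR (- e * t) * (p t * cos (y * t) + q t * sin (y * t))) =
  laplace_re u v e y + (a * (e / (e ^+ 2 + y ^+ 2)) + b * (y / (e ^+ 2 + y ^+ 2))).
Proof.
move=> e0 mp mq mu_ mv uM vM pu qv.
rewrite -Rintegral_exp_cos// -Rintegral_exp_sin//.
have ibnd (g : R -> R) : measurable_fun setT g -> (forall t, `|g t| <= 1) ->
    mu.-integrable setT (EFin \o (fun t => damp e t * g t)).
  by move=> mg g1; apply: (integrable_mul_bounded (integrable_damp e0) mg g1).
have ic := ibnd _ (measurable_cosM y) (fun t => cos_max _).
have is' := ibnd _ (measurable_sinM y) (fun t => sin_max _).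
have iac := integrable_scale a measurableT ic.
have ibs := integrable_scale b measurableT is'.
have iuv := integrable_damp_rotation mu_ mv uM vM e0 (measurable_cosM y)
  (measurable_sinM y) (fun t => cos_max _) (fun t => sin_max _).
rewrite (dampE e (fun t => cos (y * t))) (dampE e (fun t => sin (y * t))).
rewrite -!RintegralZl// /laplace_re -RintegralD// -RintegralD//; last first.
  exact: (integrableD _ iac ibs).
transitivity (\int[mu]_(t in `[0, +oo[) (expR (- e * t) *
    ((u t + a) * cos (y * t) + (v t + b) * sin (y * t)))).
  apply: Rintegral_ae_eq => //.
  - apply: measurable_funM.
      by apply: measurable_funTS; exact: measurable_expM.
    apply: measurable_funD; apply: measurable_funM => //; apply: measurable_funTS.
      exact: measurable_cosM.
    exact: measurable_sinM.
  - apply: measurable_funTS; apply: measurable_funM.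
      exact: measurable_expM.
    apply: measurable_funD; apply: measurable_funM => //; first exact: measurable_funD.
    + exact: measurable_cosM.
    + exact: measurable_funD.
    + exact: measurable_sinM.
  - move: pu qv; apply: filterS2; first exact: (ae_filter_ringOfSetsType mu).
    by move=> t pt qt t0; rewrite pt// qt.
rewrite dampE; apply: eq_Rintegral => t _ /=; ring.
Qed.

(** Subtracting [alpha / s] from the transform amounts to subtracting [alpha] from
    the function on the half line. *)
Lemma laplaceB psi u v M a b e y : 0 < e ->
  cmeasurable nonneg psi ->
  measurable_fun setT u -> measurable_fun setT v ->
  (forall t, `|u t| <= M) -> (forall t, `|v t| <= M) ->
  (\forall t \ae mu, nonneg t -> complex.Re (psi t) = u t + a) ->
  (\forall t \ae mu, nonneg t -> complex.Im (psi t) = v t + b) ->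
  laplace psi (e +i* y) - (a +i* b) / (e +i* y) =
  laplace_re u v e y +i* laplace_re v (\- u) e y.
Proof.
move=> e0 [mre mim] mu_ mv uM vM pu pv.
have -> : laplace psi (e +i* y) =
  (\int[mu]_(t in `[0, +oo[) (expR (- e * t) *
     (complex.Re (psi t) * cos (y * t) + complex.Im (psi t) * sin (y * t)))) +i*
  (\int[mu]_(t in `[0, +oo[) (expR (- e * t) *
     (complex.Im (psi t) * cos (y * t) + - complex.Re (psi t) * sin (y * t)))).
  rewrite /laplace /cintegral /cexp; congr (_ +i* _); apply: eq_Rintegral => t _;
  case: (psi t) => p q /=;
  rewrite !mulr0 subr0 add0r cosN sinN mulNr; ring.
have nuM t : `|(\- u) t| <= M by rewrite /= normrN.
have mnu : measurable_fun setT (\- u) by exact: measurable_funN.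
rewrite (Rintegral_laplace y e0 mre mim mu_ mv uM vM pu pv).
rewrite (Rintegral_laplace (b := - a) y e0 mim (measurable_funN mre) mv mnu vM nuM pv);
  last first.
  by move: pu; apply: ae_imp => t pt t0 /=; rewrite pt// opprD.
by apply/eqP; rewrite eq_complex/=; apply/andP; split; apply/eqP; ring.
Qed.

End assembly.

(** * Using the boundary behavior *)

Section boundary.
Context {R : realType}.
Local Notation mu := (@lebesgue_measure R).
Implicit Types (e x y t M B a b eta : R) (u v p q k : R -> R) (f psi : R -> R[i]).
Local Notation nonneg := (`[0, +oo[%classic : set R).

(** Absolute continuity of the integral. *)
Lemma L1_small f (D : set R) eta : measurable D -> L1 D f -> 0 < eta ->
  exists2 d, 0 < d & forall A : set R, measurable A -> A `<=` D -> (mu A < d%:E)%E ->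
    (\int[mu]_(y in A) (normc (f y))%:E <= eta%:E)%E.
Proof.
move=> mD [mf fi] eta0.
have mn := measurable_normc mD mf.
pose g : R -> R := (fun y : R => normc (f y) : R) \_ D.
have g0 y : 0 <= g y by rewrite /g patchE; case: ifP => // _; exact: normc_ge0.
have mg : measurable_fun setT g by exact: ((measurable_restrictT _ mD).1 mn).
have ig : mu.-integrable setT (EFin \o g).
  apply/integrableP; split; first exact/measurable_EFinP.
  apply: le_lt_trans fi; rewrite [leRHS]integral_mkcond.
  rewrite le_eqVlt; apply/orP; left; apply/eqP.
  apply: eq_integral => y _ /=; rewrite ger0_norm// /g restrict_EFin//.
have [d [d0 Hd]] := integral_normr_continuous ig eta0.
exists d => // A mA AD mAd.
have := Hd A mA mAd; rewrite /Rintegral => h.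
have -> : (\int[mu]_(y in A) (normc (f y))%:E = \int[mu]_(y in A) `|g y|%:E)%E.
  by apply: eq_integral => y /set_mem/AD Dy; rewrite ger0_norm// /g patchE mem_set.
rewrite -lte_fin in h; apply: le_trans (ltW h).
rewrite fineK//; apply: integrable_fin_num => //.
by apply: (@integrableS _ _ _ mu setT) => //; exact: (integrable_norm ig).
Qed.

(** [`|f| <= `|f - F| + `|F|]: the first term is small in the mean over the whole
    interval for [e] close to 0, the second over a short interval by absolute
    continuity. The point is that [r] is chosen before [e]. *)
Lemma H1_boundary_small (f : R[i] -> R[i]) :
  (forall e, 0 < e -> cmeasurable setT (fun y => f (e +i* y))) ->
  H1_boundary_behavior f 0 ->
  forall eta, 0 < eta -> exists2 r, 0 < r & \forall e \near 0^'+,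
    (\int[mu]_(y in `](- r)%R, r[) (normc (f (e +i* y)))%:E <= eta%:E)%E.
Proof.
move=> mf [delta d0 [F LF [_ cvF]]] eta eta0.
rewrite !sub0r !add0r in LF cvF.
have eta2 : 0 < eta / 2 by rewrite divr_gt0.
have mD : measurable (`]- delta, delta[%classic : set R) by [].
have [d dgt0 Hd] := L1_small mD LF eta2.
pose r := Num.min delta (d / 4).
have r0 : 0 < r by rewrite lt_min d0 divr_gt0.
have rdelta : r <= delta by rewrite ge_min lexx.
have rd : r <= d / 4 by rewrite ge_min lexx orbT.
have AD : `]- r, r[%classic `<=` (`]- delta, delta[%classic : set R).
  by move=> y /=; rewrite !in_itv/=; lra.
exists r => //.
have FA : (\int[mu]_(y in `](- r)%R, r[) (normc (F y))%:E <= (eta / 2)%:E)%E.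
  apply: Hd => //; rewrite lebesgue_measure_itv/= lte_fin.
  by case: ifP => _; rewrite -?EFinD lte_fin; lra.
have near_small : \forall e \near 0^'+,
    (\int[mu]_(y in `](- delta)%R, delta[)
      (normc (f (e +i* y)%C - F y)%R)%:E < (eta / 2)%:E)%E.
  have N : nbhs (0%E : \bar R) [set z : \bar R | (z < (eta / 2)%:E)%E].
    apply: open_nbhs_nbhs; split; first exact: open_ereal_lt_ereal.
    by rewrite /= lte_fin.
  exact: (cvF _ N).
near=> e.
have e0 : 0 < e by near: e; exact: nbhs_right_gt.
have mA : measurable (`]- r, r[%classic : set R) by [].
have [mfr mfi] := mf e e0.
have [[mFr mFi] _] := LF.
have mdiff (D : set R) : measurable D -> D `<=` (`]- delta, delta[%classic : set R) ->
    measurable_fun D (fun y => normc (f (e +i* y) - F y)).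
  move=> mD' sD; apply: measurable_normc => //; split.
  - rewrite (_ : (fun x => _) = (fun x => complex.Re (f (e +i* x)) - complex.Re (F x))).
      apply: measurable_funB; first exact: measurable_funTS.
      exact: measurable_funS mFr.
    by apply/funext => x; case: (f _) => ? ?; case: (F x).
  - rewrite (_ : (fun x => _) = (fun x => complex.Im (f (e +i* x)) - complex.Im (F x))).
      apply: measurable_funB; first exact: measurable_funTS.
      exact: measurable_funS mFi.
    by apply/funext => x; case: (f _) => ? ?; case: (F x).
have mFA : measurable_fun (`]- r, r[%classic : set R) (fun y => normc (F y)).
  apply: measurable_normc => //.
  by split; [exact: measurable_funS mFr|exact: measurable_funS mFi].
apply: (@le_trans _ _ (\int[mu]_(y in `](- r)%R, r[)
    ((normc (f (e +i* y) - F y)%R)%:E + (normc (F y))%:E))%E).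
  apply: ge0_le_integral => //=.
  - by move=> y _; rewrite lee_fin normc_ge0.
  - apply/measurable_EFinP; apply: measurable_normc => //.
    by split; exact: measurable_funTS.
  - apply: emeasurable_funD; apply/measurable_EFinP => //.
    exact: mdiff.
  - by move=> y _; rewrite -EFinD lee_fin -[X in normc X <= _](subrK (F y)) le_normcD.
rewrite ge0_integralD//=; last 4 first.
- by move=> y _; rewrite lee_fin normc_ge0.
- by apply/measurable_EFinP; exact: mdiff.
- by move=> y _; rewrite lee_fin normc_ge0.
- exact/measurable_EFinP.
rewrite [eta in leRHS]splitr EFinD; apply: leeD => //.
apply: (@le_trans _ _ (\int[mu]_(y in `](- delta)%R, delta[)
    (normc (f (e +i* y)%C - F y)%R)%:E)%E).
  apply: ge0_subset_integral => //.
  - by apply/measurable_EFinP; exact: mdiff.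
  - by move=> y _; rewrite lee_fin normc_ge0.
by apply: ltW; near: e.
Unshelve. all: by end_near. Qed.

Lemma laplace_re_small psi u v M a b :
  cmeasurable nonneg psi ->
  measurable_fun setT u -> measurable_fun setT v ->
  (forall t, `|u t| <= M) -> (forall t, `|v t| <= M) ->
  (\forall t \ae mu, nonneg t -> complex.Re (psi t) = u t + a) ->
  (\forall t \ae mu, nonneg t -> complex.Im (psi t) = v t + b) ->
  H1_boundary_behavior (fun s => laplace psi s - (a +i* b) / s) 0 ->
  forall eta, 0 < eta -> exists2 r, 0 < r & \forall e \near 0^'+,
    \int[mu]_(y in `]- r, r[)
      (`|laplace_re u v e y| + `|laplace_re v (\- u) e y|) <= eta.
Proof.
move=> mpsi mu_ mv uM vM pu pv H1 eta eta0.
have GE e y : 0 < e -> laplace psi (e +i* y) - (a +i* b) / (e +i* y) =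
  laplace_re u v e y +i* laplace_re v (\- u) e y.
  by move=> e0; exact: (laplaceB y e0 mpsi mu_ mv uM vM pu pv).
have nuM t : `|(\- u) t| <= M by rewrite /= normrN.
have mnu : measurable_fun setT (\- u) by exact: measurable_funN.
have mG e : 0 < e -> cmeasurable setT
    (fun y => laplace psi (e +i* y) - (a +i* b) / (e +i* y)).
  move=> e0; under eq_fun do rewrite GE//.
  split => /=; first exact: (measurable_laplace_re mu_ mv uM vM).
  exact: (measurable_laplace_re mv mnu vM nuM).
have eta2 : 0 < eta / 2 by rewrite divr_gt0.
have [r r0 Hr] := H1_boundary_small mG H1 eta2.
exists r => //; near=> e.
have e0 : 0 < e by near: e; exact: nbhs_right_gt.
have : (\int[mu]_(y in `](- r)%R, r[)
   (normc (laplace psi (e +i* y) - (a +i* b) / (e +i* y)))%:E <= (eta / 2)%:E)%E by near: e.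
have mA : measurable (`]- r, r[%classic : set R) by [].
have mN : measurable_fun (`]- r, r[%classic : set R)
    (fun y => normc (laplace psi (e +i* y) - (a +i* b) / (e +i* y))).
  apply: measurable_normc => //.
  by have [h1 h2] := mG e e0; split; exact: measurable_funTS.
set I := (X in (X <= _)%E) => HI.
have J : (\int[mu]_(y in `](- r)%R, r[)
   (`|laplace_re u v e y| + `|laplace_re v (\- u) e y|)%R%:E <= eta%:E)%E.
  apply: (@le_trans _ _ (2%:E * I)%E); last first.
    rewrite [X in (_ <= X%:E)%E](_ : eta = 2 * (eta / 2)); last by field.
    by rewrite EFinM; apply: lee_wpmul2l => //; rewrite lee_fin.
  rewrite /I -ge0_integralZl//; last 2 first.
  - exact/measurable_EFinP.
  - by move=> y _; rewrite lee_fin normc_ge0.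
  apply: ge0_le_integral => //.
  - apply/measurable_EFinP; apply: measurable_funTS; apply: measurable_funD;
    apply: measurableT_comp => //.
      exact: (measurable_laplace_re mu_ mv uM vM).
    exact: (measurable_laplace_re mv mnu vM nuM).
  - by apply/measurable_EFinP; exact: measurable_funM.
  move=> y _; rewrite GE// -EFinM lee_fin.
  have := Re_le_normc (laplace_re u v e y +i* laplace_re v (\- u) e y).
  have := Im_le_normc (laplace_re u v e y +i* laplace_re v (\- u) e y).
  by rewrite [complex.Re _]/= [complex.Im _]/=; lra.
rewrite /Rintegral -lee_fin fineK// ge0_fin_numE; first exact: le_lt_trans J (ltry _).
by apply: integral_ge0 => y _; rewrite lee_fin addr_ge0.
Unshelve. all: by end_near. Qed.

End boundary.

(** * Conclusion *)

Section conclusion.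
Context {R : realType}.
Local Notation mu := (@lebesgue_measure R).
Implicit Types (e x y t M B a b eta theta : R) (u v p q k : R -> R) (f psi : R -> R[i]).
Local Notation nonneg := (`[0, +oo[%classic : set R).

(** Clipping at the essential bound and extending by 0 yields a function that is
    measurable and bounded everywhere, at the price of an equality that holds only
    almost everywhere. *)
Lemma bounded_representative p N a : 0 <= N -> measurable_fun nonneg p ->
  (\forall t \ae mu, nonneg t -> `|p t| <= N) ->
  exists u, [/\ measurable_fun setT u, forall t, `|u t| <= N + `|a|,
    forall t, t < 0 -> u t = 0 & \forall t \ae mu, nonneg t -> p t = u t + a].
Proof.
move=> N0 mp pN.
pose c t := Num.max (- N) (Num.min N (p t)).
have cN t : `|c t| <= N.
  by rewrite ler_norml /c le_max lexx ge_max ge_min lexx; lra.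
pose u : R -> R := (fun t => c t - a) \_ nonneg.
have mc : measurable_fun nonneg (fun t => c t - a).
  apply: measurable_funB => //; apply: measurable_maxr => //.
  exact: measurable_minr.
exists u; split.
- exact: ((measurable_restrictT _ (measurable_itv _)).1 mc).
- move=> t; rewrite /u patchE; case: ifP => _; last by rewrite normr0 addr_ge0.
  by rewrite (le_trans (ler_normB _ _))// lerD2r.
- by move=> t t0; rewrite /u patchE memNset//= in_itv/= andbT leNgt t0.
- move: pN; apply: ae_imp => t pt t0; rewrite /u patchE mem_set// subrK.
  have := pt t0; rewrite ler_norml => /andP[p1 p2].
  by rewrite /c min_r// max_r.
Qed.

Lemma Linfty_ae_bound (D : set R) psi : Linfty D psi ->
  exists2 N : R, 0 <= N & \forall t \ae mu, D t -> normc (psi t) <= N.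
Proof.
move=> [_]; have := ess_sup_ge mu (EFin \o ((fun x => normc (psi x)) \_ D)).
rewrite -/(Linfty_norm D psi); case: (Linfty_norm D psi) => [N| |]// H _.
- exists `|N| => //; move: H; apply: ae_imp => t + Dt.
  by rewrite /= patchE mem_set// lee_fin => /le_trans; apply; exact: ler_norm.
- by exists 0 => //; move: H; apply: ae_imp => t.
Qed.

Lemma Linfty_representatives psi a b : Linfty nonneg psi -> exists u v M,
  [/\ measurable_fun setT u /\ measurable_fun setT v,
      forall t, `|u t| <= M /\ `|v t| <= M,
      forall t, t < 0 -> u t = 0 /\ v t = 0,
      \forall t \ae mu, nonneg t -> complex.Re (psi t) = u t + a &
      \forall t \ae mu, nonneg t -> complex.Im (psi t) = v t + b].
Proof.
move=> Lpsi; have [N N0 HN] := Linfty_ae_bound Lpsi.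
have [[mre mim] _] := Lpsi.
have HR : \forall t \ae mu, nonneg t -> `|complex.Re (psi t)| <= N.
  by move: HN; apply: ae_imp => t h /h; apply: le_trans; exact: Re_le_normc.
have HI : \forall t \ae mu, nonneg t -> `|complex.Im (psi t)| <= N.
  by move: HN; apply: ae_imp => t h /h; apply: le_trans; exact: Im_le_normc.
have [u [mu_ uM u0 pu]] := bounded_representative a N0 mre HR.
have [v [mv vM v0 pv]] := bounded_representative b N0 mim HI.
exists u, v, (N + `|a| + `|b|); split => // t.
- split; first by rewrite (le_trans (uM t))// lerDl.
  by rewrite (le_trans (vM t))// lerD2r lerDl.
- by move=> t0; rewrite u0 ?v0.
Qed.

Lemma Linfty_normc (f : R -> R[i]) : Linfty setT f ->
  exists2 B, 0 <= B & \forall x \ae mu, normc (f x) <= B.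
Proof.
move=> /Linfty_ae_bound[B B0 HB]; exists B => //.
by move: HB; apply: ae_imp => x; apply.
Qed.

Lemma cmeasurable_lin (c : R[i]) (f g : R -> R[i]) :
  cmeasurable setT f -> cmeasurable setT g -> cmeasurable setT (fun x => c * f x + g x).
Proof.
case: c => a b [fr fi] [gr gi]; split.
- rewrite (_ : (fun x => _) = (fun x =>
      a * complex.Re (f x) - b * complex.Im (f x) + complex.Re (g x))).
    by apply: measurable_funD => //; apply: measurable_funB; exact: measurable_funM.
  by apply/funext => x; case: (f x); case: (g x).
- rewrite (_ : (fun x => _) = (fun x =>
      a * complex.Im (f x) + b * complex.Re (f x) + complex.Im (g x))).
    by apply: measurable_funD => //; apply: measurable_funD; exact: measurable_funM.
  by apply/funext => x; case: (f x); case: (g x).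
Qed.

Lemma Linfty_lin (c : R[i]) (f g : R -> R[i]) : Linfty setT f -> Linfty setT g ->
  Linfty setT (fun x => c * f x + g x).
Proof.
move=> Lf Lg; have [A A0 fA] := Linfty_normc Lf; have [B B0 gB] := Linfty_normc Lg.
apply: (@Linfty_bounded _ _ (normc c * A + B)).
  by apply: cmeasurable_lin; [case: Lf|case: Lg].
move: fA gB; apply: filterS2; first exact: (ae_filter_ringOfSetsType mu).
move=> x h1 h2; rewrite (le_trans (le_normcD _ _))// lerD// normcM.
by rewrite ler_wpM2l// normc_ge0.
Qed.

Lemma cmeasurable_zero_extension psi : cmeasurable nonneg psi ->
  cmeasurable setT (zero_extension psi).
Proof.
move=> [mr mi]; split.
- rewrite (_ : (fun x => _) = (fun x => complex.Re (psi x)) \_ nonneg).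
    exact: ((measurable_restrictT _ (measurable_itv _)).1 mr).
  apply/funext => x; rewrite patchE mem_setE in_itv/= andbT /zero_extension.
  by case: ifP.
- rewrite (_ : (fun x => _) = (fun x => complex.Im (psi x)) \_ nonneg).
    exact: ((measurable_restrictT _ (measurable_itv _)).1 mi).
  apply/funext => x; rewrite patchE mem_setE in_itv/= andbT /zero_extension.
  by case: ifP.
Qed.

Lemma Linfty_tail : Linfty setT (fun x => if 0 <= x then 0 else -1 : R[i]).
Proof.
apply: (@Linfty_bounded _ _ 1).
  split.
    rewrite (_ : (fun x => _) = (fun x => \1_nonneg x - 1)).
      by apply: measurable_funB => //; exact: measurable_indic.
    apply/funext => x; rewrite indicE mem_setE in_itv/= andbT.
    by case: ifP => _ /=; rewrite ?subrr ?sub0r.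
  rewrite (_ : (fun x => _) = cst 0); first exact: measurable_cst.
  by apply/funext => x; case: ifP => _ /=; rewrite ?oppr0.
apply: aeW => x; case: ifP => _; first by rewrite normc0.
by rewrite normcN /= expr1n expr0n addr0 sqrtr1.
Qed.

Lemma tail_Tplus phi : Tplus phi -> phi (fun x => if 0 <= x then 0 else -1) = 0.
Proof.
move=> [_ _ H]; apply: H; first exact: Linfty_tail.
apply: cvg_near_cst; near=> x.
rewrite ifT//; near: x; exact: nbhs_pinfty_ge (num_real _).
Unshelve. all: by end_near. Qed.

(** Almost everywhere [zero_extension psi] equals [alpha * (1 + s) + w], where [s] is
    minus the indicator of the negative axis and [w = u + i v]. A mean in [Tplus] is 1
    at the constant 1, kills [s] because [s] vanishes near +oo, and kills [w] by
    [smoothable_mean0]. The null function [n] is the discrepancy. *)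
Lemma smoothable_one_sided psi u v M a b :
  Linfty nonneg psi ->
  measurable_fun setT u -> measurable_fun setT v ->
  (forall t, `|u t| <= M) -> (forall t, `|v t| <= M) ->
  (forall t, t < 0 -> u t = 0) -> (forall t, t < 0 -> v t = 0) ->
  (\forall t \ae mu, nonneg t -> complex.Re (psi t) = u t + a) ->
  (\forall t \ae mu, nonneg t -> complex.Im (psi t) = v t + b) ->
  uniformly_smoothable u v ->
  one_sidedly_almost_convergent (zero_extension psi) (a +i* b).
Proof.
move=> Lpsi mu_ mv uM vM u0 v0 pu pv H phi Tphi.
have [[dphi pos phi1] iphi _] := Tphi.
pose w x := u x +i* v x.
pose s x : R[i] := if 0 <= x then 0 else -1.
pose n x : R[i] := -1 * ((a +i* b) * (1 * 1 + s x) + w x) + zero_extension psi x.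
have [C C0 HC] := Linfty_dual_bound dphi.
have mw : cmeasurable setT w by [].
have Lw : Linfty setT w.
  apply: (@Linfty_bounded _ _ (M + M)) => //; apply: aeW => t.
  by rewrite (le_trans (normc_le_Re_Im _))//= lerD.
have Ls : Linfty setT s by exact: Linfty_tail.
have L1' : Linfty setT (fun=> 1 : R[i]).
  by apply: (@Linfty_bounded _ _ 1); [split; exact: measurable_cst|
    apply: aeW => x; rewrite /= expr1n expr0n addr0 sqrtr1].
have L1s : Linfty setT (fun x => 1 * 1 + s x) by exact: (Linfty_lin 1 L1' Ls).
have n0 : \forall x \ae mu, normc (n x) <= 0.
  move: pu pv; apply: filterS2; first exact: (ae_filter_ringOfSetsType mu).
  move=> x px qx; rewrite (_ : n x = 0) ?normc0//.
  rewrite /n /s /zero_extension; case: ifPn => x0.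
    have x0' : nonneg x by rewrite /= in_itv/= x0.
    have -> : psi x = (a +i* b) + w x.
      apply/eqP; rewrite eq_complex/= px// qx//.
      by rewrite ![_ + a]addrC ![_ + b]addrC !eqxx.
    ring.
  have -> : w x = 0 by rewrite /w u0 ?v0 ?ltNge.
  ring.
have mn : cmeasurable setT n.
  apply: cmeasurable_lin; last by apply: cmeasurable_zero_extension; case: Lpsi.
  by apply: cmeasurable_lin => //; case: L1s.
have Ln := Linfty_bounded mn n0.
have pn : phi n = 0.
  apply: eq0_normc; apply/eqP; rewrite eq_le normc_ge0 andbT.
  by rewrite (le_trans (HC _ _ mn n0))// mulr0.
have pw : phi w = 0 by exact: (smoothable_mean0 dphi iphi mu_ mv uM vM H).
have ps : phi s = 0 by exact: tail_Tplus.
have Lwn : Linfty setT (fun x => 1 * w x + n x) by exact: Linfty_lin.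
rewrite (_ : zero_extension psi = fun x => (a +i* b) * (1 * 1 + s x) + (1 * w x + n x)).
  have lin := dphi.1.
  rewrite (lin _ _ _ L1s Lwn) (lin 1 _ _ L1' Ls) (lin 1 _ _ Lw Ln).
  by rewrite phi1 pn pw ps !addr0 !mulr1 mulr0 addr0.
apply/funext => x; rewrite /n; ring.
Qed.

Lemma smoothable_uniform_average psi u v M a b :
  cmeasurable nonneg psi ->
  measurable_fun setT u -> measurable_fun setT v ->
  (forall t, `|u t| <= M) -> (forall t, `|v t| <= M) ->
  (\forall t \ae mu, nonneg t -> complex.Re (psi t) = u t + a) ->
  (\forall t \ae mu, nonneg t -> complex.Im (psi t) = v t + b) ->
  uniformly_smoothable u v ->
  forall eta, 0 < eta -> exists theta0 : R, forall theta x, theta0 <= theta -> nonneg x ->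
    normc ((theta^-1)%:C * cintegral `[x, x + theta] psi - (a +i* b)) <= eta.
Proof.
move=> [mre mim] mu_ mv uM vM pu pv H eta eta0.
have eta2 : 0 < eta / 2 by rewrite divr_gt0.
have [|r r0 Hr] := smoothable_average mu_ uM _ eta2.
  by move=> e e0; have [k kd Hk] := H e e0; exists k => // x; have [] := Hk x.
have [|s s0 Hs] := smoothable_average mv vM _ eta2.
  by move=> e e0; have [k kd Hk] := H e e0; exists k => // x; have [] := Hk x.
exists (Num.max r s) => theta x; rewrite ge_max => /andP[rt st] nx.
have x0 : 0 <= x by move: nx; rewrite /= in_itv/= andbT.
have th0 : 0 < theta by exact: lt_le_trans rt.
have sub : `[x, x + theta]%classic `<=` nonneg.
  by move=> t /=; rewrite !in_itv/= andbT => /andP[+ _]; exact: le_trans.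
have avg p (w : R -> R) (c : R) : measurable_fun nonneg p -> measurable_fun setT w ->
    (forall t, `|w t| <= M) -> (\forall t \ae mu, nonneg t -> p t = w t + c) ->
    `|\int[mu]_(z in `[x, x + theta]) w z| <= theta * (eta / 2) ->
    `|theta^-1 * \int[mu]_(t in `[x, x + theta]) p t - c| <= eta / 2.
  move=> mp mw wM pw Hw.
  have icst (m : R) : mu.-integrable `[x, x + theta] (EFin \o cst m).
    apply: continuous_compact_integrable; first exact: segment_compact.
    by apply: continuous_subspaceT => z; exact: cvg_cst.
  have iw : mu.-integrable `[x, x + theta] (EFin \o w).
    apply: (integrable_le _ _ (icst M)) => //.
    exact: measurable_funTS.
  rewrite (@Rintegral_ae_eq R _ p (fun t => w t + c))//; last 3 first.
  - exact: measurable_funS mp.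
  - by apply: measurable_funTS; exact: measurable_funD.
  - by move: pw; apply: ae_imp => t pt /sub.
  have cstE : \int[mu]_(t in `[x, x + theta]) (cst c t) = c * theta.
    rewrite [LHS](@Rintegral_cst _ _ _ mu `[x, x + theta])//=.
    by rewrite lebesgue_measure_itv/= lte_fin ltrDl th0/= addrAC subrr add0r.
  rewrite (RintegralD _ iw (icst c))// cstE.
  have -> : theta^-1 * (\int[mu]_(t in `[x, x + theta]) w t + c * theta) - c =
    theta^-1 * \int[mu]_(t in `[x, x + theta]) w t by field; rewrite gt_eqF.
  by rewrite normrM gtr0_norm ?invr_gt0// mulrC ler_pdivrMr// mulrC.
apply: (le_trans (normc_le_Re_Im _)).
rewrite [eta in leRHS]splitr; apply: lerD => /=.
  by rewrite mul0r subr0; apply: avg mre mu_ uM pu _; exact: Hr.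
by rewrite mul0r addr0; apply: avg mim mv vM pv _; exact: Hs.
Qed.

End conclusion.

Theorem corollary8p2 (R : realType) (psi : R -> R[i]) (alpha : R[i]) :
  Linfty `[0, +oo[ psi ->
  H1_boundary_behavior (fun s : R[i] => laplace psi s - alpha / s) 0 ->
  one_sidedly_almost_convergent (zero_extension psi) alpha /\
  {uniform `[0%R, +oo[,
    (fun theta x : R => (theta^-1)%:C * cintegral `[x, x + theta] psi : R[i]^o)
      @ +oo --> cst (alpha : R[i]^o)}.
Proof.
case: alpha => a b Lpsi H1.
have [u [v [M [[mu_ mv] uvM uv0 pu pv]]]] := Linfty_representatives a b Lpsi.
have uM t : `|u t| <= M by have [] := uvM t.
have vM t : `|v t| <= M by have [] := uvM t.
have u0 t : t < 0 -> u t = 0 by move=> /uv0[].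
have v0 t : t < 0 -> v t = 0 by move=> /uv0[].
have [mpsi _] := Lpsi.
have small := laplace_re_small mpsi mu_ mv uM vM pu pv H1.
have smooth := laplace_re_smoothable mu_ mv uM vM u0 v0 small.
split; first exact: (smoothable_one_sided Lpsi mu_ mv uM vM u0 v0 pu pv smooth).
apply: uniform_cvg_normc.
exact: (smoothable_uniform_average mpsi mu_ mv uM vM pu pv smooth).
Qed.
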